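(* Let $Y$ be a continuous Lagrangian path on $[a,b]$. Then $$\mathcal N(Y,[a,b])=\operatorname{Mas}(E,Y,[a,b]),$$ where $E=\begin{pmatrix}0\\ I\end{pmatrix}$ is regarded as the constant vertical Lagrangian path on $[a,b]$.
   Context: Notation. $n\in\mathbb N$, $[a,b]\subseteq\mathbb R$, $\mathcal J=\begin{pmatrix}0&I\\ -I&0\end{pmatrix}\in\mathbb R^{2n\times2n}$, $E=\begin{pmatrix}0\\ I\end{pmatrix}\in\mathbb R^{2n\times n}$. A real $2n\times 2n$ matrix $S$ is symplectic if $S^T\mathcal JS=\mathcal J$. A Lagrangian plane is a constant $Y\in\mathbb R^{2n\times n}$ with $Y^T\mathcal JY=0$ and $\operatorname{rank}Y=n$. A continuous Lagrangian path on $[a,b]$ is a continuous $Y:[a,b]\to\mathbb R^{2n\times n}$ such that every $Y(t)$ is a Lagrangian plane. We write $Y=\begin{pmatrix}X\\ U\end{pmatrix}$ with $n\times n$ blocks (similarly $\hat Y$ with $\hat X,\hat U$). The Wronskian is $W(Y,\hat Y)=Y^T\mathcal J\hat Y$. Comparative index. For Lagrangian planes $Y,\hat Y$ put $\mathcal M=(I-X^\dagger X)W(Y,\hat Y)$, $V=I-\mathcal M^\dagger\mathcal M$, $\mathcal P=V[W(Y,\hat Y)]^TX^\dagger\hat XV$ (a symmetric matrix), where $\dagger$ is the Moore–Penrose pseudoinverse. The comparative index is $\mu(Y,\hat Y)=\operatorname{rank}\mathcal M+\operatorname{ind}\mathcal P$, with $\operatorname{ind}$ the number of negative eigenvalues.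 Oscillation number. For a continuous Lagrangian path $Y$ on $[a,b]$ take a partition $a=t_0<t_1<\dots<t_p=b$ and real symplectic matrix functions $R_k(t)$, $k=0,\dots,p-1$, with $R_k$ continuous on $[t_k,t_{k+1}]$ and such that, for each $k$, both $\operatorname{rank}W(R_k(t)E,Y(t))$ and $\operatorname{rank}\big((I\ \,0)R_k(t)E\big)$ are constant for $t\in[t_k,t_{k+1}]$. Then $$\mathcal N(Y,[a,b]):=\sum_{k=0}^{p-1}\big[\mu(Y(t_{k+1}),R_k(t_{k+1})E)-\mu(Y(t_k),R_k(t_k)E)\big].$$ Such partitions and systems exist and the value does not depend on their choice. Maslov index. For continuous Lagrangian paths $Y,\hat Y$ put $$\Gamma(t)=-[X(t)+iU(t)][X(t)-iU(t)]^{-1}[\hat X(t)-i\hat U(t)][\hat X(t)+i\hat U(t)]^{-1},$$ a continuous unitary matrix on $[a,b]$. There exist a partition $a=t_0<t_1<\dots<t_p=b$ and numbers $\varepsilon_k\in(0,\pi)$, $k=1,\dots,p$, such that $\Gamma(t)-\exp\{i(\pi\pm\varepsilon_k)\}I$ is invertible for all $t\in[t_{k-1},t_k]$. For $t\in[t_{k-1},t_k]$ let $\ell(t,\varepsilon_k)=\sum_{\theta\in[0,\varepsilon_k)}\dim\ker\big(\Gamma(t)-\exp\{i(\pi+\theta)\}I\big)$, i.e. the number of eigenvalues (with multiplicity) of $\Gamma(t)$ on the arc $\{e^{i\theta}:\theta\in[\pi,\pi+\varepsilon_k)\}$. The Maslov index is $$\operatorname{Mas}(Y,\hat Y,[a,b]):=\sum_{k=1}^p\big(\ell(t_k,\varepsilon_k)-\ell(t_{k-1},\varepsilon_k)\big),$$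 which is independent of the choice of the partition and the $\varepsilon_k$. *)

(* Defs.v *)
From HB Require Import structures.
From mathcomp Require Import all_boot all_order all_algebra.
From mathcomp Require Import complex.
From mathcomp Require Import all_classical all_reals all_analysis.

Set Implicit Arguments.
Unset Strict Implicit.
Unset Printing Implicit Defensive.

Import Order.TTheory GRing.Theory Num.Theory.
Import numFieldNormedType.Exports.

Local Open Scope classical_set_scope.
Local Open Scope ring_scope.
Local Open Scope complex_scope.

Definition is_mp_inverse (R : realFieldType) m n (A : 'M[R]_(m, n))
    (B : 'M[R]_(n, m)) : Prop :=
  [/\ A *m B *m A = A, B *m A *m B = B,
      (A *m B)^T = A *m B & (B *m A)^T = B *m A].

(* The Moore-Penrose pseudoinverse. [pinvmx] is only some partial inverse and
   need not satisfy the two symmetry conditions. *)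
Definition mp_inverse (R : realFieldType) m n (A : 'M[R]_(m, n)) : 'M[R]_(n, m) :=
  xget 0 [set B | is_mp_inverse A B].

Lemma row_free_gram (R : realFieldType) m n (A : 'M[R]_(m, n)) :
  row_free A -> A *m A^T \in unitmx.
Proof.
move=> Afree; rewrite -row_free_unit -kermx_eq0; apply/rowV0P => v /sub_kermxP.
move=> vAA; have vA0 : v *m A = 0.
  have : (v *m A) *m (v *m A)^T = 0.
    by rewrite trmx_mul mulmxA -(mulmxA v) vAA mul0mx.
  move/(congr1 (fun M : 'M[R]_1 => M 0 0)); rewrite !mxE => /eqP.
  rewrite psumr_eq0 => [/allP s0|j _]; last by rewrite !mxE sqr_ge0.
  apply/rowP => j; rewrite [RHS]mxE; have := s0 j (mem_index_enum j).
  by rewrite (mxE _ _ j 0) mulf_eq0 orbb => /eqP.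
by apply: (row_free_inj Afree); rewrite mul0mx.
Qed.

Lemma is_mp_inverse_unique (R : realFieldType) m n (A : 'M[R]_(m, n)) B C :
  is_mp_inverse A B -> is_mp_inverse A C -> B = C.
Proof.
move=> [b1 b2 b3 b4] [c1 c2 c3 c4].
have AB : A *m B = A *m C.
  rewrite -b3 -{1}c1 -mulmxA trmx_mul b3 c3 mulmxA.
  by rewrite b1.
have BA : B *m A = C *m A.
  rewrite -b4 -{1}c1 -mulmxA mulmxA trmx_mul c4.
  by rewrite b4 -!mulmxA (mulmxA A) b1.
by rewrite -b2 -mulmxA AB mulmxA BA c2.
Qed.

Lemma mp_inverseP (R : realFieldType) m n (A : 'M[R]_(m, n)) :
  is_mp_inverse A (mp_inverse A).
Proof.
rewrite /mp_inverse; case: xgetP => [B _ //|noB]; exfalso.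
have [r [C [F [Cfree Ffree defA]]]] : exists r (C : 'M[R]_(m, r)) (F : 'M[R]_(r, n)),
    [/\ row_free C^T, row_free F & A = C *m F].
  exists (\rank A), (col_base A), (row_base A).
  split; rewrite ?row_base_free ?mulmx_base // -row_leq_rank mxrank_tr.
  by rewrite col_leq_rank col_base_full.
have FU : F *m F^T \in unitmx by apply: row_free_gram.
have CU : C^T *m C \in unitmx by rewrite -{2}(trmxK C); apply: row_free_gram.
pose FV := F^T *m invmx (F *m F^T); pose CV := invmx (C^T *m C) *m C^T.
have FFV : F *m FV = 1%:M by rewrite mulmxA mulmxV.
have CVC : CV *m C = 1%:M by rewrite -mulmxA mulVmx.
have AB : A *m (FV *m CV) = C *m CV.
  by rewrite defA -mulmxA (mulmxA F) FFV mul1mx.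
have BA : (FV *m CV) *m A = FV *m F.
  by rewrite defA -mulmxA (mulmxA CV) CVC mul1mx.
apply: (noB (FV *m CV)); split.
- by rewrite AB defA -mulmxA (mulmxA CV) CVC mul1mx.
- by rewrite BA -mulmxA (mulmxA F) FFV mul1mx.
- by rewrite AB !trmx_mul trmxK trmx_inv trmx_mul trmxK mulmxA.
- by rewrite BA !trmx_mul trmxK trmx_inv trmx_mul trmxK mulmxA.
Qed.

(* R^(2n x k) is ['M_(n + n, k)]: a 2n x n matrix Y has blocks
   X = [usubmx Y] and U = [dsubmx Y]. *)
Definition symp_J (R : realType) n : 'M[R]_(n + n) :=
  block_mx 0 1%:M (- 1%:M) 0.

Definition vert (R : realType) n : 'M[R]_(n + n, n) := col_mx 0 1%:M.

Definition symplectic (R : realType) n (S : 'M[R]_(n + n)) : Prop :=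
  S^T *m symp_J R n *m S = symp_J R n.

Definition wronskian (R : realType) n (Y Yh : 'M[R]_(n + n, n)) : 'M[R]_n :=
  Y^T *m symp_J R n *m Yh.

Definition lagrangian_plane (R : realType) n (Y : 'M[R]_(n + n, n)) : Prop :=
  Y^T *m symp_J R n *m Y = 0 /\ \rank Y = n.

(* [Y] is a total function, but only its restriction to [a, b] matters. *)
Definition lagrangian_path (R : realType) n (a b : R)
    (Y : R -> 'M[R]_(n + n, n)) : Prop :=
  {within `[a, b], continuous Y} /\
  (forall t, t \in `[a, b] -> lagrangian_plane (Y t)).

(* The number of negative eigenvalues, with multiplicity. The sum has finite
   support; geometric and algebraic multiplicities agree for the symmetric
   matrices it is used for. *)
Definition neg_index (R : realType) n (A : 'M[R]_n) : nat :=
  \sum_(x \in [set x : R | x < 0]) \rank (eigenspace A x).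

Definition comp_index (R : realType) n (Y Yh : 'M[R]_(n + n, n)) : nat :=
  let X := usubmx Y in
  let Xh := usubmx Yh in
  let W := wronskian Y Yh in
  let M := (1%:M - mp_inverse X *m X) *m W in
  let V := 1%:M - mp_inverse M *m M in
  let P := V *m W^T *m mp_inverse X *m Xh *m V in
  (\rank M + neg_index P)%N.

(* For [itv_partition a b s], i.e. a < s_0 < s_1 < ... = b, the k-th point of
   the partition, with [part_pt a s 0 = a]. The k-th interval, [k < size s], is
   [part_pt a s k, part_pt a s k.+1]. *)
Definition part_pt (R : realType) (a : R) (s : seq R) (k : nat) : R :=
  nth a (a :: s) k.

Definition osc_admissible (R : realType) n (c d : R)
    (Y : R -> 'M[R]_(n + n, n)) (S : R -> 'M[R]_(n + n)) : Prop :=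
  [/\ {within `[c, d], continuous S},
      forall t, t \in `[c, d] -> symplectic (S t),
      forall t u, t \in `[c, d] -> u \in `[c, d] ->
        \rank (wronskian (S t *m vert R n) (Y t)) =
        \rank (wronskian (S u *m vert R n) (Y u)) &
      forall t u, t \in `[c, d] -> u \in `[c, d] ->
        \rank (row_mx 1%:M 0 *m S t *m vert R n : 'M[R]_n) =
        \rank (row_mx 1%:M 0 *m S u *m vert R n : 'M[R]_n)].

Definition osc_sum (R : realType) n (a : R) (Y : R -> 'M[R]_(n + n, n))
    (s : seq R) (S : nat -> R -> 'M[R]_(n + n)) : int :=
  \sum_(k < size s)
    let mu t := (comp_index (Y t) (S k t *m vert R n))%:Z in
    mu (part_pt a s k.+1) - mu (part_pt a s k).

Definition is_osc_number (R : realType) n (a b : R)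
    (Y : R -> 'M[R]_(n + n, n)) (N : int) : Prop :=
  exists (s : seq R) (S : nat -> R -> 'M[R]_(n + n)),
    [/\ itv_partition a b s,
        forall k, (k < size s)%N ->
          osc_admissible (part_pt a s k) (part_pt a s k.+1) Y (S k) &
        N = osc_sum a Y s S].

(* The common value of all admissible sums; the default 0 is irrelevant for a
   Lagrangian path, since such sums exist. *)
Definition osc_number (R : realType) n (Y : R -> 'M[R]_(n + n, n))
    (a b : R) : int :=
  xget 0 [set N | is_osc_number a b Y N].

Definition expi (R : realType) (x : R) : R[i] := cos x +i* sin x.

(* X + iU and X - iU. *)
Definition cplane (R : realType) n (Y : 'M[R]_(n + n, n)) : 'M[R[i]]_n :=
  \matrix_(i, j) (usubmx Y i j +i* dsubmx Y i j).

Definition cplane_conj (R : realType) n (Y : 'M[R]_(n + n, n)) : 'M[R[i]]_n :=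
  \matrix_(i, j) (usubmx Y i j -i* dsubmx Y i j).

Definition maslov_Gamma (R : realType) n (Y Yh : 'M[R]_(n + n, n)) :
    'M[R[i]]_n :=
  - (cplane Y *m invmx (cplane_conj Y) *m
     cplane_conj Yh *m invmx (cplane Yh)).

(* The eigenvalues of [G] on the arc [pi, pi + e). For 0 < e < pi the sum has
   finite support, because [expi] is injective on this arc. *)
Definition arc_count (R : realType) n (G : 'M[R[i]]_n) (e : R) : nat :=
  \sum_(x \in [set x : R | 0 <= x < e])
    \rank (eigenspace G (expi (pi + x))).

Definition maslov_admissible (R : realType) n (c d e : R)
    (Y Yh : R -> 'M[R]_(n + n, n)) : Prop :=
  0 < e < pi /\
  forall t, t \in `[c, d] ->
    maslov_Gamma (Y t) (Yh t) - (expi (pi + e))%:M \in unitmx /\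
    maslov_Gamma (Y t) (Yh t) - (expi (pi - e))%:M \in unitmx.

Definition maslov_sum (R : realType) n (a : R) (Y Yh : R -> 'M[R]_(n + n, n))
    (s : seq R) (e : nat -> R) : int :=
  \sum_(k < size s)
    let l t := (arc_count (maslov_Gamma (Y t) (Yh t)) (e k))%:Z in
    l (part_pt a s k.+1) - l (part_pt a s k).

Definition is_maslov_index (R : realType) n (a b : R)
    (Y Yh : R -> 'M[R]_(n + n, n)) (N : int) : Prop :=
  exists (s : seq R) (e : nat -> R),
    [/\ itv_partition a b s,
        forall k, (k < size s)%N ->
          maslov_admissible (part_pt a s k) (part_pt a s k.+1) (e k) Y Yh &
        N = maslov_sum a Y Yh s e].

(* As for [osc_number], the default 0 is irrelevant for Lagrangian paths. *)
Definition maslov_index (R : realType) n (Y Yh : R -> 'M[R]_(n + n, n))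
    (a b : R) : int :=
  xget 0 [set N | is_maslov_index a b Y Yh N].

(* Main.v *)
Require Import Defs.
From HB Require Import structures.
From mathcomp Require Import all_boot all_order all_algebra.
From mathcomp Require Import complex ring lra zify.
From mathcomp Require Import all_classical all_reals all_analysis.

Set Implicit Arguments.
Unset Strict Implicit.
Unset Printing Implicit Defensive.

Import Order.TTheory GRing.Theory Num.Theory.
Import numFieldNormedType.Exports.

Local Open Scope classical_set_scope.
Local Open Scope ring_scope.

(* For T > 0 such that the plane L_T = {X = T U} is transversal to Y, write Y as
   the graph of a symmetric matrix A = slope T Y over the coordinate
   T U - X. If Yh is another such plane, with slope B, comparing two
   diagonalizations of the form [[A, B], [B, B]] gives
     mu(Y, Yh) = ind (A - B) + ind B - ind A.
   Along an interval where rank W(Yh, Y) = rank (A - B) and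
   rank Xh = rank B are constant, ind (A - B) and ind B are constant (ind is
   lower semicontinuous and the rank is a sum of two indices), so
   mu(Y, Yh) + ind A is locally constant; hence the increments of mu(Y, Yh) do
   not depend on Yh, and N(Y) does not depend on the choices made.
   On the other hand, Gamma v = exp(i (pi + x)) v amounts to
   (cos (x/2) X - sin (x/2) U) w = 0, so that for T = tan (e/2) the arc
   [pi, pi + e) is carried by x |-> tan (x/2) / (T - tan (x/2)) onto the
   nonnegative spectrum of A, and its eigenvalue count is mu(Y, L_T). Thus
   every admissible Maslov sum is an oscillation sum for constant planes L_T. *)

(** * Spectral theorem for real symmetric matrices *)

Lemma rank_diag_mx (F : fieldType) n (d : 'rV[F]_n) :
  \rank (diag_mx d) = (\sum_i (d 0 i != 0)%R)%N.
Proof.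
elim: n d => [|n IHn] d; first by rewrite big_ord0 flatmx0 mxrank0.
rewrite -[n.+1]/(1 + n)%N in d *.
rewrite -(hsubmxK d) diag_mx_row rank_diag_block_mx IHn big_split_ord /=.
rewrite big_ord1; congr addn.
- rewrite row_mxEl rank_rV; congr (nat_of_bool (~~ _)).
  apply/eqP/eqP => [/matrixP/(_ 0 0)|d0].
    by rewrite !mxE eqxx mulr1n.
  by apply/matrixP => i j; rewrite !ord1 !mxE; move: d0; rewrite !mxE => ->.
- by apply: eq_bigr => i _; rewrite row_mxEr.
Qed.

Lemma diag_mx_quad (R : comNzRingType) n (d : 'rV[R]_n) (v : 'rV[R]_n) :
  (v *m diag_mx d *m v^T) 0 0 = \sum_i d 0 i * v 0 i ^+ 2.
Proof.
rewrite mul_mx_diag mxE; apply: eq_bigr => i _.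
by rewrite !mxE mulrAC -expr2 mulrC.
Qed.

(** Over the complex numbers the matrix is Hermitian, so it has a real spectral value. That value is
    a root of the real characteristic polynomial, hence it already has a real eigenvector. *)
Lemma symmetric_eigenvector (R : realType) n (A : 'M[R]_n.+1) :
  A^T = A -> exists a (v : 'rV[R]_n.+1), v != 0 /\ v *m A = a *: v.
Proof.
move=> symA; pose AC := map_mx (real_complex R) A.
have realAC : AC \is a mxOver Num.real.
  by apply/mxOverP => i j; rewrite mxE; apply/complex_realP; exists (A i j).
have symAC : AC \is hermitianmx _ false Num.Def.conjC.
  apply: realsym_hermsym => //; apply/is_hermitianmxP.
  by rewrite expr0 scale1r map_mx_id // map_trmx symA.
have /mxOverP/(_ 0 0)/complex_realP[a sd_a] := hermitian_spectral_diag_real symAC.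
have /orthomx_spectralP := hermitian_normalmx symAC.
set P := spectralmx AC; set sp := spectral_diag AC => defAC.
have Pu : P \in unitmx by apply: spectral_unit.
have : eigenvalue AC (real_complex R a).
  apply/eigenvalueP; exists (row 0 P).
    rewrite [X in _ *m X]defAC !mulmxA -row_mul mulmxV // row1 -rowE row_diag_mx sd_a.
    by rewrite -scalemxAl -rowE.
  apply/eqP => /(congr1 (mulmxr (invmx P))) /=.
  rewrite -row_mul mulmxV // row1 mul0mx => /matrixP/(_ 0 0)/eqP.
  by rewrite !mxE !eqxx oner_eq0.
rewrite eigenvalue_root_char -map_char_poly fmorph_root -eigenvalue_root_char.
by move=> /eigenvalueP[v vA v0]; exists a, v.
Qed.

Lemma row_mul_tr_eq0 (R : realFieldType) n (v : 'rV[R]_n) :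
  (v *m v^T) 0 0 = 0 -> v = 0.
Proof.
have -> : (v *m v^T) 0 0 = \sum_i v 0 i ^+ 2.
  by rewrite mxE; apply: eq_bigr => i _; rewrite mxE expr2.
move=> /eqP; rewrite psumr_eq0 => [/allP s0|i _]; last exact: sqr_ge0.
apply/rowP => i; rewrite [RHS]mxE; have := s0 i (mem_index_enum i).
by rewrite sqrf_eq0 => /eqP.
Qed.

(* The witness is the Householder reflection exchanging v and the first basis
   vector. *)
Lemma unit_row_reflection (R : realFieldType) n (v : 'rV[R]_n.+1) :
  v *m v^T = 1%:M ->
  exists H : 'M[R]_n.+1, [/\ H^T = H, H *m H = 1%:M & delta_mx 0 0 *m H = v].
Proof.
move=> vv; pose e : 'rV[R]_n.+1 := delta_mx 0 0; pose w := v - e.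
have ee : e *m e^T = 1%:M.
  by rewrite trmx_delta mul_delta_mx; apply/matrixP => i j; rewrite !ord1 !mxE.
have ev : e *m v^T = (v 0 0)%:M.
  by rewrite -rowE; apply/matrixP => i j; rewrite !ord1 !mxE eqxx mulr1n.
have ve : v *m e^T = (v 0 0)%:M.
  by rewrite -[LHS]trmxK trmx_mul trmxK ev tr_scalar_mx.
have ww : w *m w^T = (2 * (1 - v 0 0))%:M.
  rewrite /w linearB /= mulmxBl !mulmxBr vv ve ev ee.
  by apply/matrixP => i j; rewrite !mxE !ord1 !eqxx !mulr1n; ring.
have ew : e *m w^T = (v 0 0 - 1)%:M.
  rewrite /w linearB /= mulmxBr ev ee.
  by apply/matrixP => i j; rewrite !mxE !ord1 !eqxx !mulr1n.
have we : w = v - e by [].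
(* The squared length of [w] is 2 (1 - [v 0 0]). If it vanishes, [v] is the first basis vector and
   the identity serves; otherwise the reflection along [w] is defined. *)
clearbody w; have [v1|v1] := eqVneq (v 0 0) 1.
  have w0 : w = 0.
    by apply: row_mul_tr_eq0; rewrite ww v1 subrr mulr0 mxE.
  exists 1%:M; rewrite trmx1 mul1mx mulmx1; split=> //.
  by apply/esym/eqP; rewrite -subr_eq0 -we w0.
have c0 : 1 - v 0 0 != 0 by rewrite subr_eq0 eq_sym.
pose c := (1 - v 0 0)^-1; exists (1%:M - c *: (w^T *m w)); split.
- by rewrite linearB /= trmx1 linearZ /= trmx_mul trmxK.
- rewrite mulmxBl mul1mx mulmxBr mulmx1 -scalemxAl -scalemxAr.
  rewrite mulmxA -(mulmxA w^T) ww scalar_mxC mul_scalar_mx -scalemxAl.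
  rewrite !scalerA; move: (w^T *m w) => M.
  by apply/matrixP => i j; rewrite !mxE /c; field.
- rewrite mulmxBr mulmx1 -scalemxAr mulmxA ew mul_scalar_mx scalerA.
  have -> : c * (v 0 0 - 1) = -1 by rewrite /c; field.
  by rewrite scaleN1r opprK we addrC subrK.
Qed.

(** Induction on the size: the reflection taking the first basis vector to a unit eigenvector
    conjugates [A] to a block diagonal matrix, whose lower block is diagonalized by induction. *)
Lemma symmetric_spectral (R : realType) n (A : 'M[R]_n) : A^T = A ->
  exists (Q : 'M[R]_n) (d : 'rV[R]_n),
    Q *m Q^T = 1%:M /\ A = Q^T *m diag_mx d *m Q.
Proof.
elim: n A => [|n IHn] A symA.
  by exists 1%:M, 0; split; rewrite [LHS]flatmx0 [RHS]flatmx0.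
have [a [v0 [v00 v0A]]] := symmetric_eigenvector symA.
pose c := (v0 *m v0^T) 0 0.
have c_gt0 : 0 < c.
  rewrite lt_def; apply/andP; split.
    by apply: contraNN v00 => /eqP/row_mul_tr_eq0 ->.
  by rewrite /c mxE sumr_ge0 // => i _; rewrite !mxE -expr2 sqr_ge0.
pose v := (Num.sqrt c)^-1 *: v0.
have vv : v *m v^T = 1%:M.
  rewrite /v linearZ /= -scalemxAr -scalemxAl scalerA [v0 *m _]mx11_scalar -/c.
  rewrite -invfM -expr2 sqr_sqrtr ?ltW // scale_scalar_mx mulVf //.
  by rewrite gt_eqF.
have vA : v *m A = a *: v by rewrite /v -scalemxAl v0A !scalerA mulrC.
have [H [symH HH eH]] := unit_row_reflection vv.
pose B : 'M[R]_(1 + n) := H *m A *m H.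
have symB : B^T = B by rewrite /B !trmx_mul symA symH mulmxA.
have rowB : row 0 B = a *: delta_mx 0 0.
  by rewrite rowE /B !mulmxA eH vA -scalemxAl -eH -mulmxA HH mulmx1.
have defA : A = H *m B *m H by rewrite /B -!mulmxA HH mulmx1 mulmxA HH mul1mx.
clearbody B; have Bu : ursubmx B = 0.
  apply/matrixP => i j; rewrite !ord1 !mxE.
  have /matrixP/(_ 0 (rshift 1 j)) := rowB.
  rewrite !mxE (_ : (rshift 1 j == 0) = false) ?mulr0 // => E.
  by rewrite -[RHS]E; congr fun_of_matrix; apply/val_inj.
have defB : B = block_mx (a%:M) 0 0 (drsubmx B).
  rewrite -[LHS]submxK Bu -[dlsubmx B]trmxK trmx_dlsub symB Bu trmx0; congr block_mx.
  apply/matrixP => i j; rewrite !ord1 !mxE eqxx mulr1n.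
  have /matrixP/(_ 0 0) := rowB; rewrite !mxE eqxx mulr1 => <-.
  by congr fun_of_matrix; apply/val_inj.
have [|Q [d [QQ defD]]] := IHn (drsubmx B); first by rewrite trmx_drsub symB.
pose Q' : 'M[R]_(1 + n) := block_mx 1%:M 0 0 Q.
have QQ' : Q' *m Q'^T = 1%:M.
  rewrite /Q' tr_block_mx !trmx0 mulmx_block !(mulmx0, mul0mx) trmx1 mulmx1 QQ.
  by rewrite !addr0 add0r -scalar_mx_block.
pose d' : 'rV[R]_(1 + n) := row_mx a%:M d.
have defB' : B = Q'^T *m diag_mx d' *m Q'.
  rewrite /Q' /d' defB diag_mx_row tr_block_mx !trmx0 !mulmx_block.
  rewrite !(mulmx0, mul0mx, addr0, add0r, trmx1, mul1mx, mulmx1) -defD.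
  by congr block_mx; apply/matrixP => i j; rewrite !ord1 !mxE eqxx.
exists (Q' *m H), d'; split.
  by rewrite trmx_mul symH mulmxA -(mulmxA Q') HH mulmx1 QQ'.
by rewrite defA defB' trmx_mul symH !mulmxA.
Qed.

Section spectral_counts.
Context (R : realType) (n : nat) (A Q : 'M[R]_n) (d : 'rV[R]_n).
Hypotheses (QQ : Q *m Q^T = 1%:M) (defA : A = Q^T *m diag_mx d *m Q).

Let Qu : Q \in unitmx. Proof. by case/mulmx1_unit: QQ. Qed.

Let QTQ : Q^T *m Q = 1%:M. Proof. exact: mulmx1C. Qed.

Lemma rank_spectral : \rank A = (\sum_i (d 0 i != 0)%R)%N.
Proof.
rewrite defA mxrankMfree ?row_free_unit // -mxrank_tr trmx_mul trmxK.
by rewrite mxrankMfree ?row_free_unit // mxrank_tr rank_diag_mx.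
Qed.

Lemma rank_eigenspace_spectral x :
  \rank (eigenspace A x) = (\sum_i (d 0 i == x)%R)%N.
Proof.
rewrite mxrank_ker.
have -> : A - x%:M = Q^T *m diag_mx (d - const_mx x) *m Q.
  rewrite linearB /= diag_const_mx mulmxBr mulmxBl -defA scalar_mxC -mulmxA QTQ.
  by rewrite mul_scalar_mx scalemx1.
rewrite mxrankMfree ?row_free_unit // -mxrank_tr trmx_mul trmxK.
rewrite mxrankMfree ?row_free_unit // mxrank_tr rank_diag_mx.
rewrite -[X in (X - _)%N]card_ord -sum1_card -sumnB => [|i _]; last exact: leq_b1.
by apply: eq_bigr => i _; rewrite !mxE subr_eq0; case: eqP.
Qed.

Lemma sum_rank_eigenspace (I : set R) :
  \sum_(x \in I) \rank (eigenspace A x) = (\sum_i (d 0 i \in I)%R)%N.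
Proof.
(* The distinct diagonal entries lying in [I] carry the whole support of the sum. *)
pose r := undup [seq d 0 i | i <- enum 'I_n & d 0 i \in I].
rewrite (fsbigE r) ?undup_uniq //=; first last.
- move=> x Ix xr; rewrite rank_eigenspace_spectral; apply: big1 => i _.
  have [dx|//] := eqVneq; exfalso; move/negP: xr; apply; rewrite mem_undup.
  by apply/mapP; exists i; rewrite // mem_filter mem_enum dx andbT inE.
- move=> x /=; rewrite mem_undup => xr.
  have [i + ->] := elimT mapP xr.
  by rewrite mem_filter => /andP[Ii _]; apply: set_mem.
rewrite (eq_bigr _ (fun x _ => rank_eigenspace_spectral x)).
rewrite exchange_big; apply: eq_bigr => i _ /=.
have [Ii|Ii] := boolP (d 0 i \in I).
  have ir : d 0 i \in r.
    by rewrite mem_undup; apply/mapP; exists i; rewrite // mem_filter Ii mem_enum.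
  rewrite big_mkcond (bigD1_seq (d 0 i)) ?undup_uniq //= Ii eqxx big1_seq // => x.
  by rewrite eq_sym => /andP[/negPf-> _]; rewrite if_same.
apply: big1 => x Ix; have [dx|//] := eqVneq; move: Ix; rewrite -dx.
by rewrite (negPf Ii).
Qed.

Lemma neg_index_spectral : neg_index A = (\sum_i (d 0 i < 0)%R)%N.
Proof.
rewrite /neg_index sum_rank_eigenspace; apply: eq_bigr => i _; congr nat_of_bool.
by apply/idP/idP; rewrite inE.
Qed.

End spectral_counts.

(** * The negative index *)

(** The rows of [B] span a test subspace. Strict negativity at every nonzero [v] forces them to be
    independent, so that subspace has dimension [k]. *)
Definition negdef_on (R : realType) k n (B : 'M[R]_(k, n)) (A : 'M[R]_n) :=
  forall v : 'rV[R]_k, v != 0 -> (v *m (B *m A *m B^T) *m v^T) 0 0 < 0.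

(** Projection of the test space to the negative eigendirections is injective: on a vector without
    negative components the form is nonnegative. *)
Lemma negdef_on_leq (R : realType) k n (B : 'M[R]_(k, n)) (A : 'M[R]_n) :
  A^T = A -> negdef_on B A -> (k <= neg_index A)%N.
Proof.
move=> symA negB; have [Q [d [QQ defA]]] := symmetric_spectral symA.
rewrite (neg_index_spectral QQ defA).
pose e : 'rV[R]_n := \row_i (d 0 i < 0)%R%:R.
have -> : (\sum_i (d 0 i < 0)%R)%N = \rank (diag_mx e).
  rewrite rank_diag_mx; apply: eq_bigr => i _.
  by rewrite mxE; case: (_ < _)%R; rewrite ?oner_eq0 ?eqxx.
have /eqP <- : row_free (B *m Q^T *m diag_mx e); last exact: mxrankM_maxr.
rewrite -kermx_eq0; apply/rowV0P => v /sub_kermxP vB0.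
apply/eqP; apply: contraT => /negB; rewrite ltNge => /negP[].
have -> : v *m (B *m A *m B^T) *m v^T =
    (v *m (B *m Q^T)) *m diag_mx d *m (v *m (B *m Q^T))^T.
  by rewrite defA !trmx_mul trmxK !mulmxA.
rewrite diag_mx_quad; apply: sumr_ge0 => i _.
have [d_lt0|d_ge0] := ltP (d 0 i) 0; last by rewrite mulr_ge0 ?sqr_ge0.
have /matrixP/(_ 0 i) := vB0; rewrite mulmxA mul_mx_diag [RHS]mxE mxE [e 0 i]mxE d_lt0.
by rewrite mulr1 => ->; rewrite expr0n mulr0.
Qed.

Lemma mulmxKtr (R : comNzRingType) m n (B : 'M[R]_(m, n)) (Q : 'M[R]_n) :
  Q *m Q^T = 1%:M -> B *m Q *m Q^T = B.
Proof. by move=> QQ; rewrite -mulmxA QQ mulmx1. Qed.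

(** The eigenvectors with negative eigenvalues span a test space of maximal dimension. *)
Lemma negdef_on_neg_index (R : realType) n (A : 'M[R]_n) : A^T = A ->
  exists B : 'M[R]_(neg_index A, n), negdef_on B A.
Proof.
move=> symA; have [Q [d [QQ defA]]] := symmetric_spectral symA.
pose e : 'rV[R]_n := \row_i (d 0 i < 0)%R%:R.
have -> : neg_index A = \rank (diag_mx e).
  rewrite (neg_index_spectral QQ defA) rank_diag_mx; apply: eq_bigr => i _.
  by rewrite mxE; case: (_ < _)%R; rewrite ?oner_eq0 ?eqxx.
exists (row_base (diag_mx e) *m Q) => v v0; pose w := v *m row_base (diag_mx e).
have -> : v *m (row_base (diag_mx e) *m Q *m A *m (row_base (diag_mx e) *m Q)^T) *m v^T
    = w *m diag_mx d *m w^T.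
  by rewrite /w defA !trmx_mul !mulmxA !(mulmxKtr _ QQ).
have /submxP[u wu] : (w <= diag_mx e)%MS.
  by apply: submx_trans (submxMl _ _) _; rewrite eq_row_base.
have w0 : w != 0.
  apply: contra_neq v0 => w0; apply: (row_free_inj (row_base_free (diag_mx e))).
  by rewrite -/w w0 mul0mx.
have wi i : w 0 i = u 0 i * (d 0 i < 0)%R%:R by rewrite wu mul_mx_diag !mxE.
rewrite diag_mx_quad lt_neqAle; apply/andP; split; last first.
  apply: sumr_le0 => i _; rewrite wi; have [di|_] := ltP (d 0 i) 0.
    by rewrite mulr_le0_ge0 ?sqr_ge0 // ltW.
  by rewrite mulr0 expr0n mulr0.
apply: contra_neq w0 => s0; apply/rowP => i; rewrite [RHS]mxE.
have s_ge0 j : true -> 0 <= - (d 0 j * w 0 j ^+ 2).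
  move=> _; rewrite wi; have [di|_] := ltP (d 0 j) 0.
    by rewrite oppr_ge0 mulr_le0_ge0 ?sqr_ge0 // ltW.
  by rewrite mulr0 expr0n mulr0 oppr0.
have /eqP : \sum_j - (d 0 j * w 0 j ^+ 2) = 0 by rewrite sumrN s0 oppr0.
rewrite psumr_eq0 // => /allP/(_ i (mem_index_enum i)) /=.
rewrite oppr_eq0 mulf_eq0 sqrf_eq0 => /orP[/eqP d0|/eqP //].
by rewrite wi d0 ltxx mulr0.
Qed.

Lemma trmx_congr (R : comNzRingType) m n (C : 'M[R]_(m, n)) (A : 'M[R]_n) :
  A^T = A -> (C *m A *m C^T)^T = C *m A *m C^T.
Proof. by move=> symA; rewrite !trmx_mul trmxK symA mulmxA. Qed.

Lemma neg_index_congr_leq (R : realType) m n (C : 'M[R]_(m, n)) (A : 'M[R]_n) :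
  A^T = A -> (neg_index (C *m A *m C^T) <= neg_index A)%N.
Proof.
move=> symA; have [B negB] := negdef_on_neg_index (trmx_congr C symA).
apply: (@negdef_on_leq _ _ _ (B *m C)) => // v /negB.
by rewrite trmx_mul !mulmxA.
Qed.

(** Sylvester's law of inertia, with [C] and [C'] possibly rectangular and not mutually inverse.
    This freedom allows a degenerate variable to be duplicated or merged. *)
Lemma neg_index_congr (R : realType) m n (C : 'M[R]_(m, n)) (C' : 'M[R]_(n, m))
    (A : 'M[R]_n) (B : 'M[R]_m) :
  A^T = A -> B = C *m A *m C^T -> A = C' *m B *m C'^T ->
  neg_index B = neg_index A.
Proof.
move=> symA defB defA; have symB : B^T = B by rewrite defB trmx_congr.
apply/eqP; rewrite eqn_leq; apply/andP; split.
  by rewrite defB neg_index_congr_leq.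
by rewrite defA neg_index_congr_leq.
Qed.

Lemma neg_index_scale (R : realType) n (A : 'M[R]_n) c :
  0 < c -> A^T = A -> neg_index (c *: A) = neg_index A.
Proof.
move=> c_gt0 symA; have [s s0 <-] : exists2 s, s != 0 & s * s = c.
  exists (Num.sqrt c); first by rewrite sqrtr_eq0 -ltNge.
  by rewrite -expr2 sqr_sqrtr // ltW.
apply: (@neg_index_congr _ _ _ s%:M s^-1%:M) => //.
  by rewrite tr_scalar_mx mul_scalar_mx mul_mx_scalar scalerA.
rewrite tr_scalar_mx mul_scalar_mx mul_mx_scalar !scalerA.
by rewrite -[LHS]scale1r; congr (_ *: _); field.
Qed.

Lemma neg_index_block_diag (R : realType) m n (A : 'M[R]_m) (B : 'M[R]_n) :
  A^T = A -> B^T = B ->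
  neg_index (block_mx A 0 0 B) = (neg_index A + neg_index B)%N.
Proof.
move=> symA symB; have [Q [d [QQ defA]]] := symmetric_spectral symA.
have [Q' [d' [QQ' defB]]] := symmetric_spectral symB.
pose Q'' := block_mx Q 0 0 Q'.
have QQ'' : Q'' *m Q''^T = 1%:M.
  rewrite /Q'' tr_block_mx !trmx0 mulmx_block !(mulmx0, mul0mx) QQ QQ'.
  by rewrite !addr0 add0r -scalar_mx_block.
rewrite (neg_index_spectral QQ defA) (neg_index_spectral QQ' defB).
rewrite (@neg_index_spectral _ _ _ Q'' (row_mx d d')) //.
  rewrite big_split_ord /=; congr addn; apply: eq_bigr => i _.
    by rewrite row_mxEl.
  by rewrite row_mxEr.
rewrite /Q'' diag_mx_row tr_block_mx !trmx0 !mulmx_block.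
by rewrite !(mulmx0, mul0mx, addr0, add0r) -defA -defB.
Qed.

Lemma neg_index_addN (R : realType) n (A : 'M[R]_n) :
  A^T = A -> (neg_index A + neg_index (- A))%N = \rank A.
Proof.
move=> symA; have [Q [d [QQ defA]]] := symmetric_spectral symA.
have defNA : - A = Q^T *m diag_mx (- d) *m Q.
  by rewrite linearN /= mulmxN mulNmx -defA.
rewrite (neg_index_spectral QQ defA) (neg_index_spectral QQ defNA).
rewrite (rank_spectral QQ defA) -big_split; apply: eq_bigr => i _ /=.
by rewrite mxE oppr_lt0; case: ltgtP.
Qed.

(** * Negative index of block matrices *)

Lemma rank_block_antidiag (F : fieldType) m n (C : 'M[F]_(m, n)) :
  \rank (block_mx 0 C C^T 0) = (\rank C + \rank C)%N.
Proof.
pose S : 'M[F]_(m + n, n + m) := block_mx 0 1%:M 1%:M 0.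
have Sfree : row_free S.
  apply/row_freeP; exists (block_mx 0 1%:M 1%:M 0).
  by rewrite mulmx_block !(mulmx0, mul0mx, mulmx1, addr0, add0r) -scalar_mx_block.
rewrite -(mxrankMfree _ Sfree) mulmx_block !(mulmx0, mulmx1, addr0, add0r).
by rewrite rank_diag_block_mx mxrank_tr.
Qed.

(** Changing the sign of the second variable negates the form, so its positive and negative indices
    agree and each is half of the total rank. *)
Lemma neg_index_block_antidiag (R : realType) m n (C : 'M[R]_(m, n)) :
  neg_index (block_mx 0 C C^T 0) = \rank C.
Proof.
have symH : (block_mx 0 C C^T 0)^T = block_mx 0 C C^T 0.
  by rewrite tr_block_mx !trmx0 trmxK.
pose S : 'M[R]_(m + n) := block_mx 1%:M 0 0 (- 1%:M).
have NH : neg_index (- block_mx 0 C C^T 0) = neg_index (block_mx 0 C C^T 0).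
  apply: (@neg_index_congr _ _ _ S S) => //; rewrite /S tr_block_mx !trmx0.
    rewrite !mulmx_block !(mulmx0, mul0mx, mul1mx, addr0, add0r) raddfN /= !trmx1.
    by rewrite !(mulNmx, mulmxN, mul1mx, mulmx1, mulmx0, oppr0) opp_block_mx !oppr0.
  rewrite opp_block_mx !mulmx_block !(mulmx0, mul0mx, mul1mx, addr0, add0r).
  by rewrite raddfN /= !trmx1 !(mulNmx, mulmxN, mul1mx, mulmx1, mulmx0, oppr0, opprK).
have := neg_index_addN symH; rewrite NH rank_block_antidiag !addnn.
by move/double_inj.
Qed.

(* The shift of the first variable by a multiple of the second one removes from
   G everything but its restriction to the kernel of C. *)
Lemma neg_index_block_ker (R : realType) m n (C : 'M[R]_(m, n)) (K : 'M[R]_(n, m))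
    (V G : 'M[R]_n) :
  G^T = G -> V^T = V -> C *m V = 0 -> 1%:M - V = K *m C ->
  neg_index (block_mx 0 C C^T G) = (\rank C + neg_index (V *m G *m V))%N.
Proof.
(* [Z] solves Z C + C^T Z^T = V G V - G. Of the pieces of G cut out by V and 1 - V, each mixed one
   comes entirely from one of the two summands, while the (1 - V) G (1 - V) piece is shared equally,
   whence the factor 1/2. *)
move=> symG symV CV KC; pose Z := - ((V + 2^-1 *: (1%:M - V)) *m G *m K).
have VCT : V *m C^T = 0 by rewrite -symV -trmx_mul CV trmx0.
have symVGV : (V *m G *m V)^T = V *m G *m V by rewrite !trmx_mul symV symG mulmxA.
have ZC : Z *m C + C^T *m Z^T + G = V *m G *m V.
  have -> : C^T *m Z^T = (Z *m C)^T by rewrite trmx_mul.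
  have -> : Z *m C = - ((V + 2^-1 *: (1%:M - V)) *m G *m (1%:M - V)).
    by rewrite /Z mulNmx -[_ *m K *m C]mulmxA -KC.
  have symW : (1%:M - V)^T = 1%:M - V by rewrite raddfB /= trmx1 symV.
  have symVW : (V + 2^-1 *: (1%:M - V))^T = V + 2^-1 *: (1%:M - V).
    by rewrite raddfD /= linearZ /= symV symW.
  rewrite raddfN /= !trmx_mul symVW symW symG.
  have dist := (mulmxDl, mulmxDr, mulmxN, mulNmx, mul1mx, mulmx1).
  rewrite !dist -!scalemxAl -!scalemxAr !dist -?scalemxAl -?scalemxAr !mulmxA.
  move: (V *m G *m V) (V *m G) (G *m V) => X1 X2 X3.
  by apply/matrixP => i j; rewrite !mxE; field.
clearbody Z.
have -> : neg_index (block_mx 0 C C^T G) = neg_index (block_mx 0 C C^T (V *m G *m V)).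
  apply: (@neg_index_congr _ _ _ (block_mx 1%:M 0 (- Z) 1%:M) (block_mx 1%:M 0 Z 1%:M)).
  - by rewrite tr_block_mx trmx0 trmxK symVGV.
  - rewrite tr_block_mx !trmx0 !trmx1 !mulmx_block !(mul1mx, mulmx1, mulmx0, mul0mx).
    rewrite !(add0r, addr0) -ZC raddfN /= !mulmxN !mulNmx.
    congr block_mx; first by rewrite mul0mx oppr0 add0r.
    move: (Z *m C) (C^T *m Z^T) => X1 X2.
    by apply/matrixP => i j; rewrite !mxE; ring.
  - rewrite tr_block_mx !trmx0 !trmx1 !mulmx_block !(mul1mx, mulmx1, mulmx0, mul0mx).
    by rewrite !(add0r, addr0) -ZC; congr block_mx; rewrite ?mul0mx ?add0r // addrCA addrA.
rewrite -(neg_index_block_antidiag C) -neg_index_block_diag //; last first.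
  by rewrite tr_block_mx !trmx0 trmxK.
(* The second variable is duplicated: the antidiagonal form sees only its 1 - V component and V G V
   only its V component. [S] merges the two copies, [S'] separates them. *)
pose S : 'M[R]_(m + n, (m + n) + n) := row_mx 1%:M (col_mx 0 1%:M).
pose S' : 'M[R]_((m + n) + n, m + n) :=
  col_mx (block_mx 1%:M 0 0 (1%:M - V)) (row_mx 0 V).
have VV : V *m V = V.
  by apply/eqP; rewrite -subr_eq0 -opprB oppr_eq0 -{1}[V]mul1mx -mulmxBl KC -mulmxA CV mulmx0.
have symW : (1%:M - V)^T = 1%:M - V by rewrite raddfB /= trmx1 symV.
apply/esym/(@neg_index_congr _ _ _ S' S).
- by rewrite tr_block_mx trmx0 trmxK symVGV.
- rewrite /S' tr_col_mx tr_block_mx tr_row_mx !trmx0 trmx1 symV symW.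
  rewrite mul_col_mx mul_col_row mul_row_block !mulmx_block.
  rewrite !mul_block_col !mul_row_block mul_row_col.
  rewrite !(mulmx0, mul0mx, mul1mx, mulmx1, addr0, add0r) !mulmxA !mulmxBl !mulmxBr.
  rewrite !(mul1mx, mulmx1) CV VCT !VV -!(mulmxA _ V V) !VV.
  by rewrite !subrr !subr0 col_mx0 row_mx0.
- rewrite /S tr_row_mx tr_col_mx !trmx0 !trmx1 mul_row_block mul_row_col.
  rewrite !(mulmx0, mul0mx, mul1mx, mulmx1, addr0, add0r) mul_col_mx mul_col_row.
  by rewrite !(mulmx0, mul0mx, mul1mx, mulmx1) add_block_mx !(addr0, add0r).
Qed.

(* N vanishes on the range of A, so that the first variable splits into a part
   seen by A only and a part seen by N only. *)
Lemma neg_index_block_coker (R : realType) n p (A N : 'M[R]_n) (B : 'M[R]_(n, p))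
    (G : 'M[R]_p) :
  A^T = A -> G^T = G -> N^T = N -> A *m N = 0 -> N *m N = N ->
  neg_index (block_mx A (N *m B) (N *m B)^T G) =
  (neg_index A + neg_index (block_mx 0 (N *m B) (N *m B)^T G))%N.
Proof.
move=> symA symG symN AN NN.
have NA : N *m A = 0 by rewrite -symA -symN -trmx_mul AN trmx0.
have symW : (1%:M - N)^T = 1%:M - N by rewrite raddfB /= trmx1 symN.
have symH (X : 'M[R]_n) : X^T = X ->
  (block_mx X (N *m B) (N *m B)^T G)^T = block_mx X (N *m B) (N *m B)^T G.
  by move=> symX; rewrite tr_block_mx trmxK symX symG.
rewrite -neg_index_block_diag ?symH ?trmx0 //; apply/esym.
pose S : 'M[R]_(n + p, n + (n + p)) := row_mx (col_mx 1%:M 0) 1%:M.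
pose S' : 'M[R]_(n + (n + p), n + p) :=
  col_mx (row_mx (1%:M - N) 0) (block_mx N 0 0 1%:M).
apply: (@neg_index_congr _ _ _ S' S); first exact: symH.
- rewrite /S' tr_col_mx tr_block_mx tr_row_mx !trmx0 trmx1 symN symW.
  rewrite mul_col_mx mul_col_row mul_row_block !mulmx_block.
  rewrite ?mul_row_block ?mul_block_col ?mul_row_col.
  rewrite !(mulmx0, mul0mx, mul1mx, mulmx1, addr0, add0r) !trmx_mul symN !mulmxA.
  rewrite ?mulmxBl !mulmxBr !mul1mx !mulmx1 AN NA !mul0mx NN -(mulmxA _ N N) NN.
  by rewrite !subrr !subr0 row_mx0 col_mx0.
- rewrite /S tr_row_mx tr_col_mx !trmx0 !trmx1 mul_row_block mul_row_col.
  rewrite !(mulmx0, mul0mx, mul1mx, mulmx1, addr0, add0r) mul_col_mx mul_col_row.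
  by rewrite !(mulmx0, mul0mx, mul1mx, mulmx1) add_block_mx !(addr0, add0r).
Qed.

Lemma mp_inverse_sym (R : realFieldType) n (A : 'M[R]_n) :
  A^T = A -> (mp_inverse A)^T = mp_inverse A /\ A *m mp_inverse A = mp_inverse A *m A.
Proof.
move=> symA; have [AKA KAK AKs KAs] := mp_inverseP A.
have symK : (mp_inverse A)^T = mp_inverse A.
  apply: (@is_mp_inverse_unique _ _ _ A) => //; split.
  - by have /(congr1 trmx) := AKA; rewrite !trmx_mul symA mulmxA.
  - by have /(congr1 trmx) := KAK; rewrite !trmx_mul symA mulmxA.
  - by rewrite trmx_mul trmxK symA -[X in _ = X *m _]symA -trmx_mul KAs.
  - by rewrite trmx_mul trmxK symA -[X in _ = _ *m X]symA -trmx_mul AKs.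
by split=> //; rewrite -AKs trmx_mul symK symA.
Qed.

(* Both sides count the negative directions of the form with matrix
   [[A, B], [B, B]], diagonalized in two different ways. *)
Lemma neg_index_pair (R : realType) n (A B V K : 'M[R]_n) :
  let N := 1%:M - A *m mp_inverse A in
  let C := N *m B in
  let G := B - B *m mp_inverse A *m B in
  A^T = A -> B^T = B -> V^T = V -> C *m V = 0 -> 1%:M - V = K *m C ->
  (neg_index (A - B) + neg_index B)%N =
  (neg_index A + (\rank C + neg_index (V *m G *m V)))%N.
Proof.
move=> N C G symA symB symV CV KC.
have [AKA KAK AKs KAs] := mp_inverseP A; have [symP AP] := mp_inverse_sym symA.
have symN : N^T = N by rewrite raddfB /= trmx1 AKs.
have symG : G^T = G by rewrite raddfB /= !trmx_mul symB symP mulmxA.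
have AN : A *m N = 0 by rewrite mulmxBr mulmx1 AP mulmxA AKA subrr.
have NN : N *m N = N by rewrite [LHS]mulmxBl mul1mx AP -mulmxA AN mulmx0 subr0.
have symAB : (A - B)^T = A - B by rewrite raddfB /= symA symB.
rewrite -(neg_index_block_ker symG symV CV KC) -neg_index_block_coker //.
rewrite -neg_index_block_diag // -/C.
have defC : C = B - A *m mp_inverse A *m B by rewrite [LHS]mulmxBl mul1mx.
have defCT : C^T = B - B *m mp_inverse A *m A.
  by rewrite defC raddfB /= !trmx_mul symA symB symP mulmxA.
have defG : G = B - B *m mp_inverse A *m B by [].
move: (mp_inverse A) AKA KAK symP defC defCT defG => P APA PAP symP defC defCT defG.
have PB : (B *m P)^T = P *m B by rewrite trmx_mul symP symB.
(* First diagonalization: a shear by the identity splits the form into [A - B] and [B]. *)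
transitivity (neg_index (block_mx A B B B)).
  apply/esym/(@neg_index_congr _ _ _ (block_mx 1%:M 1%:M 0 1%:M) (block_mx 1%:M (- 1%:M) 0 1%:M)).
  - by rewrite tr_block_mx !trmx0 symAB symB.
  - rewrite tr_block_mx !trmx0 !trmx1 !mulmx_block.
    by rewrite !(mulmx0, mul0mx, mul1mx, mulmx1, addr0, add0r) subrK.
  - rewrite tr_block_mx raddfN /= !trmx0 !trmx1 !mulmx_block.
    rewrite !(mulmx0, mul0mx, mul1mx, mulmx1, addr0, add0r, mulmxN, mulNmx).
    by rewrite !subrr ?oppr0 ?addr0.
(* Second one: block elimination with B P leaves the generalized Schur complement [G]. The
   off-diagonal block [C] survives because P inverts A only on its range. *)
rewrite defC in defCT *; rewrite defCT defG.
apply/esym/(@neg_index_congr _ _ _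
  (block_mx 1%:M 0 (- (B *m P)) 1%:M) (block_mx 1%:M 0 (B *m P) 1%:M)).
- by rewrite tr_block_mx symA symB.
- rewrite tr_block_mx raddfN /= !trmx0 !trmx1 !mulmx_block PB.
  rewrite !(mulmx0, mul0mx, mul1mx, mulmx1, addr0, add0r, mulmxN, mulNmx).
  rewrite mulmxDl mulNmx !mulmxA -!(mulmxA B) PAP !mulmxA.
  by rewrite addNr oppr0 add0r ![- _ + B]addrC.
- rewrite tr_block_mx !trmx0 !trmx1 !mulmx_block PB.
  rewrite !(mulmx0, mul0mx, mul1mx, mulmx1, addr0, add0r, mulmxN, mulNmx).
  rewrite mulmxDl mulmxDr mulmxN !mulmxA -!(mulmxA B) PAP !mulmxA.
  rewrite !mulmxBl -!(mulmxA B) PAP !subrr add0r.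
  by rewrite addr0 ![_ + (B + _)]addrC !subrK.
Qed.

(** * The comparative index in a graph chart *)

(** Reduces to [neg_index_pair] by removing the frames [D] and [Dh]: [M] and [C] factor through each
    other, and [P] is congruent to V' G V' up to the positive factor [T]. *)
Lemma neg_index_graph (R : realType) n (T : R) (A B D Dh W : 'M[R]_n) :
  let X := A *m D in
  let Xh := B *m Dh in
  let M := (1%:M - mp_inverse X *m X) *m W in
  let V := 1%:M - mp_inverse M *m M in
  let P := V *m W^T *m mp_inverse X *m Xh *m V in
  0 < T -> A^T = A -> B^T = B -> D \in unitmx -> Dh \in unitmx ->
  W = T^-1 *: (D^T *m (A - B) *m Dh) ->
  ((\rank M + neg_index P) + neg_index A)%N = (neg_index (A - B) + neg_index B)%N.
Proof.
move=> X Xh M V P T_gt0 symA symB Du Dhu defW.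
have T0 : T != 0 by rewrite gt_eqF.
pose N : 'M[R]_n := 1%:M - A *m mp_inverse A; pose C := N *m B.
pose V' : 'M[R]_n := 1%:M - mp_inverse C *m C; pose G : 'M[R]_n := B - B *m mp_inverse A *m B.
have [AKA KAK AKs KAs] := mp_inverseP A; have [symK AK] := mp_inverse_sym symA.
have [XX _ _ XXs] := mp_inverseP X.
have [MM _ _ MMs] := mp_inverseP M.
have [CC _ _ CCs] := mp_inverseP C.
have symV' : V'^T = V' by rewrite raddfB /= trmx1 CCs.
have CV' : C *m V' = 0 by rewrite mulmxBr mulmx1 mulmxA CC subrr.
have KV' : 1%:M - V' = mp_inverse C *m C by rewrite opprB addrC subrK.
have key := neg_index_pair symA symB symV' CV' KV'.
rewrite key addnC -/N -/C -/G; congr addn.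
have symN : N^T = N by rewrite raddfB /= trmx1 AKs.
have NA : N *m A = 0 by rewrite mulmxBl mul1mx AKA subrr.
have symV : V^T = V by rewrite raddfB /= trmx1 MMs.
have MV : M *m V = 0 by rewrite mulmxBr mulmx1 mulmxA MM subrr.
have KV : 1%:M - V = mp_inverse M *m M by rewrite opprB addrC subrK.
have symG : G^T = G by rewrite raddfB /= !trmx_mul symB symK mulmxA.
have NAK : A *m mp_inverse A = 1%:M - N by rewrite opprB addrC subrK.
have defC : C = N *m B by [].
have defG : G = B - B *m mp_inverse A *m B by [].
have defP : P = V *m W^T *m mp_inverse X *m (B *m Dh) *m V by [].
have defM : M = (1%:M - mp_inverse X *m X) *m W by [].
have defX : X = A *m D by [].
clearbody N G P X; clearbody C M; clearbody V' V.
(* [Z] annihilates A, so only the B part of W contributes to M, which becomes a multiple of Z C Dh.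
   Conversely [NZ] recovers C from M. *)
pose Z := (1%:M - mp_inverse X *m X) *m D^T.
have ZA : Z *m A = 0.
  rewrite -mulmxA -[X in _ *m (_ *m X)]symA -trmx_mul -defX mulmxBl mul1mx.
  by rewrite -XXs -trmx_mul mulmxA XX subrr.
have NZ : N *m invmx D^T *m Z = N.
  rewrite /Z mulmxBl mul1mx mulmxBr mulmxKV ?unitmx_tr // -XXs trmx_mul defX trmx_mul !mulmxA.
  by rewrite mulmxKV ?unitmx_tr // symA NA !mul0mx subr0.
have {}defM : M = - T^-1 *: (Z *m B *m Dh).
  rewrite defM defW -scalemxAr !mulmxA -/Z; move: (Z) ZA => Y YA.
  by rewrite mulmxBr YA sub0r mulNmx scalerN scaleNr.
clearbody Z.
have ZC : Z *m C = Z *m B.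
  rewrite defC -[N](subKr 1%:M) -NAK mulmxBl mul1mx mulmxBr !mulmxA ZA.
  by rewrite !mul0mx subr0.
have ZB : Z *m B = - T *: (M *m invmx Dh).
  by rewrite defM -scalemxAl mulmxK // scalerA mulrNN divff // scale1r.
have defC0 := defC; have {}defC : C = - T *: (N *m invmx D^T *m M *m invmx Dh).
  by rewrite defC -[in LHS]NZ -mulmxA ZB -scalemxAr !mulmxA.
have {}defM : M = - T^-1 *: (Z *m C *m Dh) by rewrite ZC.
have -> : \rank M = \rank C.
  apply/eqP; rewrite eqn_leq; apply/andP; split.
    rewrite defM scalemxAl; apply: leq_trans (mxrankM_maxl _ _) _.
    by rewrite scalemxAl mxrankM_maxr.
  rewrite defC scalemxAl; apply: leq_trans (mxrankM_maxl _ _) _.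
  by rewrite scalemxAl mxrankM_maxr.
(* [y] carries the range of V, the kernel of M, into the kernel of C. There B y lies in the range of
   A, so that P turns into a restriction of G. *)
congr addn; have [y defy] : exists y, y = Dh *m V by exists (Dh *m V).
have Cy : C *m y = 0.
  by rewrite defC defy -scalemxAl !mulmxA mulmxKV // -(mulmxA _ M) MV mulmx0 scaler0.
have V'y : V' *m y = y.
  by rewrite -[V'](subKr 1%:M) KV' mulmxBl mul1mx -mulmxA Cy mulmx0 subr0.
have VV' : V *m (invmx Dh *m V') = invmx Dh *m V'.
  have MV' : M *m (invmx Dh *m V') = 0.
    by rewrite defM -scalemxAl mulmxA mulmxK // -mulmxA CV' mulmx0 scaler0.
  by rewrite -[V](subKr 1%:M) KV mulmxBl mul1mx -(mulmxA _ M) MV' mulmx0 subr0.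
have By : B *m y = A *m mp_inverse A *m B *m y.
  by rewrite NAK !mulmxBl mul1mx -defC0 Cy subr0.
have XXA : X *m mp_inverse X *m A = A.
  have -> : A = X *m invmx D by rewrite defX mulmxK.
  by rewrite mulmxA XX.
have XXBy : X *m mp_inverse X *m B *m y = B *m y.
  by rewrite -(mulmxA _ B) By !mulmxA XXA.
have defP' : P = T^-1 *: (y^T *m G *m y).
  have yB : y^T *m B = y^T *m B *m mp_inverse A *m A.
    by have /(congr1 trmx) := By; rewrite !trmx_mul symA symB symK !mulmxA.
  rewrite defP defW linearZ /= -scalemxAr -!scalemxAl; congr (_ *: _).
  rewrite !trmx_mul trmxK raddfB /= symA symB !mulmxA.
  have -> : V *m Dh^T = y^T by rewrite defy trmx_mul symV.
  rewrite mulmxBr !mulmxBl -!(mulmxA _ Dh) -defy -(mulmxA _ A D) -defX.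
  have -> : y^T *m X *m mp_inverse X *m B *m y = y^T *m B *m y.
    by rewrite -[RHS]mulmxA -XXBy !mulmxA.
  have -> : y^T *m B *m D *m mp_inverse X *m B *m y =
      y^T *m B *m mp_inverse A *m B *m y.
    by rewrite [in LHS]yB -(mulmxA _ A D) -defX -[RHS]mulmxA -XXBy !mulmxA.
  by rewrite defG mulmxBr mulmxBl !mulmxA.
have defG' : V' *m G *m V' = T *: ((V' *m invmx Dh^T) *m P *m (V' *m invmx Dh^T)^T).
  rewrite defP' -scalemxAr -scalemxAl scalerA divff // scale1r.
  rewrite trmx_mul symV' trmx_inv trmxK !mulmxA.
  have VV'T : V' *m invmx Dh^T *m y^T = V'.
    have /(congr1 (mulmx Dh)) := VV'; rewrite mulKVmx // mulmxA -defy.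
    by move/(congr1 trmx); rewrite !trmx_mul symV' trmx_inv.
  rewrite VV'T -!mulmxA; congr (_ *m (_ *m _)).
  have := congr1 trmx VV'T; rewrite !trmx_mul trmxK symV' trmx_inv trmxK.
  by move=> ->.
have symP : P^T = P by rewrite defP' linearZ /= !trmx_mul trmxK symG mulmxA.
have symVGV : (V' *m G *m V')^T = V' *m G *m V' by rewrite !trmx_mul symV' symG mulmxA.
rewrite defG' neg_index_scale //; last exact: trmx_congr.
apply/esym/(@neg_index_congr _ _ _ (V' *m invmx Dh^T) y^T) => //.
have -> : V' *m invmx Dh^T *m P *m (V' *m invmx Dh^T)^T = T^-1 *: (V' *m G *m V').
  by rewrite defG' scalerA mulVf // scale1r.
have yV' : y^T *m V' = y^T by rewrite -symV' -trmx_mul V'y.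
by rewrite trmxK defP' -scalemxAr -scalemxAl !mulmxA yV' -(mulmxA _ V') V'y.
Qed.

(** The case of the plane [col_mx s%:M c%:M], which has no slope in the chart T = s / c. The
    right-hand side counts the zero and the positive eigenvalues of [A]. *)
Lemma neg_index_transversal (R : realType) n (s c : R) (A D : 'M[R]_n) :
  let X := A *m D in
  let M := (1%:M - mp_inverse X *m X) *m (- c *: D^T) in
  let V := 1%:M - mp_inverse M *m M in
  let P := V *m (- c *: D^T)^T *m mp_inverse X *m s%:M *m V in
  0 < s -> 0 < c -> A^T = A -> D \in unitmx ->
  (\rank M + neg_index P = (n - \rank A) + neg_index (- A))%N.
Proof.
move=> X M V P s_gt0 c_gt0 symA Du.
have c0 : c != 0 by rewrite gt_eqF.
have [XX _ _ XXs] := mp_inverseP X; have [MM _ _ MMs] := mp_inverseP M.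
have symV : V^T = V by rewrite raddfB /= trmx1 MMs.
have MV : M *m V = 0 by rewrite mulmxBr mulmx1 mulmxA MM subrr.
have KV : 1%:M - V = mp_inverse M *m M by rewrite opprB addrC subrK.
have defP : P = V *m (- c *: D^T)^T *m mp_inverse X *m s%:M *m V by [].
have defM : M = (1%:M - mp_inverse X *m X) *m (- c *: D^T) by [].
have defX : X = A *m D by [].
clearbody P V M X.
have XXA : X *m mp_inverse X *m A = A.
  have -> : A = X *m invmx D by rewrite defX mulmxK.
  by rewrite mulmxA XX.
have EXT : (1%:M - mp_inverse X *m X) *m X^T = 0.
  by rewrite mulmxBl mul1mx -XXs -trmx_mul mulmxA XX subrr.
have rankX : \rank X = \rank A by rewrite defX mxrankMfree // row_free_unit.
(* The left factor of M projects onto the kernel of X, and the right factor is invertible. *)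
have -> : \rank M = (n - \rank A)%N.
  have DTu : row_free (- c *: D^T).
    by rewrite row_free_unit unitmxZ ?unitmx_tr // unitfE oppr_eq0.
  rewrite defM mxrankMfree // -rankX -(mxrank_tr X) -mxrank_ker; apply/eqmx_rank.
  apply/andP; split; first exact/sub_kermxP.
  have -> : kermx X^T = kermx X^T *m (1%:M - mp_inverse X *m X).
    by rewrite mulmxBr mulmx1 -XXs trmx_mul mulmxA mulmx_ker mul0mx subr0.
  exact: submxMl.
congr addn.
(* As W is invertible here, V is the orthogonal projector onto the range of A. Hence some z
   satisfies A z = V, and P is a positive multiple of the pullback of -A by z. *)
have VA : V *m A = A.
  rewrite -[V](subKr 1%:M) KV mulmxBl mul1mx -mulmxA defM -scalemxAr -scalemxAl.
  by rewrite -mulmxA -[in D^T *m A]symA -trmx_mul -defX EXT scaler0 mulmx0 subr0.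
have XXV : X *m mp_inverse X *m V = V.
  have /eqP : M *m V = 0 by [].
  rewrite defM -scalemxAr -scalemxAl scaler_eq0 oppr_eq0 (negPf c0) /= => /eqP EV.
  have : D^T *m V = X^T *m (mp_inverse X)^T *m (D^T *m V).
    apply/eqP; rewrite -subr_eq0 -trmx_mul XXs -[X in X - _]mul1mx -mulmxBl.
    by rewrite mulmxA EV.
  move/(congr1 (mulmx (invmx D^T))); rewrite mulKmx ?unitmx_tr //.
  have -> : X^T = D^T *m A by rewrite defX trmx_mul symA.
  by rewrite -!mulmxA mulKmx ?unitmx_tr // => ->; rewrite !mulmxA XXA.
have defP' : P = (c * s) *: (- (V *m D *m mp_inverse X *m V)).
  rewrite defP linearZ /= trmxK mul_mx_scalar -!scalemxAr -!scalemxAl.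
  by rewrite scalerA scalerN -scaleNr; congr (_ *: _); ring.
have [z defz] : exists z, z = D *m mp_inverse X *m V by exists (D *m mp_inverse X *m V).
have Az : A *m z = V by rewrite defz !mulmxA -defX.
have zAz : P = (c * s) *: (z^T *m (- A) *m z).
  rewrite defP' mulmxN mulNmx; congr (_ *: - _).
  by rewrite -[in RHS]symA -trmx_mul Az symV defz !mulmxA.
have symzAz : (z^T *m (- A) *m z)^T = z^T *m (- A) *m z.
  by rewrite !trmx_mul trmxK raddfN /= symA mulmxA.
rewrite zAz neg_index_scale ?mulr_gt0 //.
apply: (@neg_index_congr _ _ _ z^T A).
- by rewrite raddfN /= symA.
- by rewrite trmxK.
- rewrite symA mulmxN mulNmx mulmxN mulNmx; congr (- _).
  have -> : z^T *m A = V by rewrite -[X in _ *m X]symA -trmx_mul Az symV.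
  have AV : A *m V = A by rewrite -[LHS]trmxK trmx_mul symV symA VA symA.
  by rewrite mulmxA AV Az VA.
Qed.

(** * Slopes of Lagrangian planes *)

Lemma wronskianE (R : realType) n (Y Yh : 'M[R]_(n + n, n)) :
  wronskian Y Yh = (usubmx Y)^T *m dsubmx Yh - (dsubmx Y)^T *m usubmx Yh.
Proof.
rewrite /wronskian /symp_J -{1}(vsubmxK Y) -{1}(vsubmxK Yh) tr_col_mx.
rewrite mul_row_block mul_row_col !(mulmx0, mulmx1, mulmxN) add0r addr0.
by rewrite addrC mulNmx.
Qed.

(** This is the Wronskian of [col_mx T%:M 1%:M] with [Y]; it is invertible exactly when [Y] is
    transversal to that plane. *)
Definition tilt (R : realType) n (T : R) (Y : 'M[R]_(n + n, n)) : 'M[R]_n :=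
  T *: dsubmx Y - usubmx Y.

Definition slope (R : realType) n (T : R) (Y : 'M[R]_(n + n, n)) : 'M[R]_n :=
  usubmx Y *m invmx (tilt T Y).

Lemma isotropic_block_sym (R : realType) n (Y : 'M[R]_(n + n, n)) :
  wronskian Y Y = 0 -> (usubmx Y)^T *m dsubmx Y = (dsubmx Y)^T *m usubmx Y.
Proof. by rewrite wronskianE => /eqP; rewrite subr_eq0 => /eqP. Qed.

Lemma slopeK (R : realType) n (T : R) (Y : 'M[R]_(n + n, n)) :
  tilt T Y \in unitmx -> slope T Y *m tilt T Y = usubmx Y.
Proof. by move=> Du; rewrite /slope mulmxKV. Qed.

Lemma tr_tilt (R : realType) n (T : R) (Y : 'M[R]_(n + n, n)) :
  (tilt T Y)^T = T *: (dsubmx Y)^T - (usubmx Y)^T.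
Proof. by rewrite raddfB /= linearZ. Qed.

(** Writing D for the tilt, isotropy makes D^T X symmetric, and the slope is its congruence by the
    inverse of D. *)
Lemma slope_sym (R : realType) n (T : R) (Y : 'M[R]_(n + n, n)) :
  wronskian Y Y = 0 -> tilt T Y \in unitmx -> (slope T Y)^T = slope T Y.
Proof.
move=> isoY Du; have XU := isotropic_block_sym isoY.
have DX : (tilt T Y)^T *m usubmx Y = (usubmx Y)^T *m tilt T Y.
  rewrite tr_tilt /tilt mulmxBl mulmxBr -scalemxAl -scalemxAr.
  by rewrite XU.
rewrite /slope trmx_mul trmx_inv.
apply: (can_inj (mulKmx (_ : (tilt T Y)^T \in unitmx))); rewrite ?unitmx_tr //.
by rewrite mulKVmx ?unitmx_tr // mulmxA DX mulmxK.
Qed.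

(** In X^T (T Uh - Xh) - (T U - X)^T Xh the products X^T Xh cancel and T times the Wronskian
    remains. *)
Lemma wronskian_slope (R : realType) n (T : R) (Y Yh : 'M[R]_(n + n, n)) :
  T != 0 -> wronskian Y Y = 0 -> tilt T Y \in unitmx -> tilt T Yh \in unitmx ->
  wronskian Y Yh =
  T^-1 *: ((tilt T Y)^T *m (slope T Y - slope T Yh) *m tilt T Yh).
Proof.
move=> T0 isoY Du Dhu; have symA := slope_sym isoY Du.
rewrite [(tilt T Y)^T *m (slope _ _ - _)]mulmxBr mulmxBl.
rewrite -{1}symA -trmx_mul slopeK // -mulmxA slopeK //.
rewrite tr_tilt /tilt wronskianE [_ *m (_ - _)]mulmxBr mulmxBl -scalemxAr -scalemxAl.
move: ((usubmx Y)^T *m usubmx Yh) (_ *m _) (_ *m _) => X1 X2 X3.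
by apply/matrixP => i j; rewrite !mxE; field.
Qed.

Lemma comp_index_slope (R : realType) n (T : R) (Y Yh : 'M[R]_(n + n, n)) :
  0 < T -> wronskian Y Y = 0 -> wronskian Yh Yh = 0 ->
  tilt T Y \in unitmx -> tilt T Yh \in unitmx ->
  (comp_index Y Yh + neg_index (slope T Y) =
   neg_index (slope T Y - slope T Yh) + neg_index (slope T Yh))%N.
Proof.
move=> T_gt0 isoY isoYh Du Dhu; have T0 : T != 0 by rewrite gt_eqF.
have := neg_index_graph T_gt0 (slope_sym isoY Du) (slope_sym isoYh Dhu) Du Dhu
  (wronskian_slope T0 isoY Du Dhu).
by rewrite /= !slopeK.
Qed.

Lemma comp_index_oblique (R : realType) n (s c : R) (Y : 'M[R]_(n + n, n)) :
  0 < s -> 0 < c -> wronskian Y Y = 0 -> tilt (s / c) Y \in unitmx ->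
  comp_index Y (col_mx s%:M c%:M) =
  (n - \rank (slope (s / c) Y) + neg_index (- slope (s / c) Y))%N.
Proof.
move=> s_gt0 c_gt0 isoY Du; have c0 : c != 0 by rewrite gt_eqF.
have defW : wronskian Y (col_mx s%:M c%:M) = - c *: (tilt (s / c) Y)^T.
  rewrite wronskianE col_mxKu col_mxKd !mul_mx_scalar tr_tilt.
  by apply/matrixP => i j; rewrite !mxE; field.
rewrite /comp_index defW col_mxKu -[usubmx Y](slopeK Du).
exact: neg_index_transversal (slope_sym isoY Du) Du.
Qed.

(** * Complex frames and the choice of a transversal plane *)

Lemma lagrangian_gram_unit (R : realType) n (Y : 'M[R]_(n + n, n)) :
  lagrangian_plane Y -> Y^T *m Y \in unitmx.
Proof.
case=> _ rankY; rewrite -{2}[Y]trmxK; apply: row_free_gram.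
by rewrite -row_leq_rank mxrank_tr rankY.
Qed.

Local Notation toC := (map_mx (real_complex _)).

Lemma cplaneE (R : realType) n (Y : 'M[R]_(n + n, n)) :
  cplane Y = toC (usubmx Y) + 'i%C *: toC (dsubmx Y).
Proof.
apply/matrixP => i j; rewrite !mxE; apply/eqP; rewrite eq_complex /=.
by rewrite !(mul0r, mul1r, mulr0, subr0, addr0, add0r) !eqxx.
Qed.

Lemma cplane_conjE (R : realType) n (Y : 'M[R]_(n + n, n)) :
  cplane_conj Y = toC (usubmx Y) - 'i%C *: toC (dsubmx Y).
Proof.
apply/matrixP => i j; rewrite !mxE; apply/eqP; rewrite eq_complex /=.
by rewrite !(mul0r, mul1r, mulr0, subr0, addr0, add0r, oppr0) !eqxx.
Qed.

(** By isotropy the imaginary terms of (X + iU)^T (X - iU) cancel. What remains is the Gram matrix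
    of Y, invertible by the rank condition. *)
Lemma cplane_unit (R : realType) n (Y : 'M[R]_(n + n, n)) : lagrangian_plane Y ->
  cplane Y \in unitmx /\ cplane_conj Y \in unitmx.
Proof.
move=> lagY; have XU := isotropic_block_sym lagY.1.
have gramE : (cplane Y)^T *m cplane_conj Y = toC (Y^T *m Y).
  rewrite -[in RHS](vsubmxK Y) tr_col_mx mul_row_col cplaneE cplane_conjE.
  have -> : (toC (usubmx Y) + 'i%C *: toC (dsubmx Y))^T =
      toC (usubmx Y)^T + 'i%C *: toC (dsubmx Y)^T.
    by apply/matrixP => i j; rewrite !mxE.
  rewrite mulmxDl !mulmxBr -!scalemxAl -!scalemxAr.
  rewrite -!map_mxM XU map_mxD scalerA -expr2 sqr_i scaleN1r opprK.
  by rewrite addrA subrK.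
have : (cplane Y)^T *m cplane_conj Y \in unitmx.
  by rewrite gramE map_unitmx lagrangian_gram_unit.
by rewrite unitmx_mul unitmx_tr => /andP[].
Qed.

(** The determinant is polynomial in T, and at T = i it is, up to sign, det (X - iU), which is
    nonzero. So all but finitely many T are transversal, and one T can serve several planes at
    once. *)
Lemma tilt_poly (R : realType) n (Y : 'M[R]_(n + n, n)) : lagrangian_plane Y ->
  exists2 p : {poly R}, p != 0 & forall T, p.[T] = \det (tilt T Y).
Proof.
move=> lagY; have [_ Zu] := cplane_unit lagY.
pose q : 'M[{poly R}]_n := 'X *: map_mx polyC (dsubmx Y) - map_mx polyC (usubmx Y).
exists (\det q); last first.
  move=> T; rewrite -horner_evalE -det_map_mx; congr (\det _).
  apply/matrixP => i j; rewrite !mxE /= horner_evalE !hornerE /=.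
  by [].
apply: contraTneq Zu => q0; rewrite unitmxE unitfE negbK.
have : (map_poly (real_complex R) (\det q)).['i%C] = 0 by rewrite q0 rmorph0 horner0.
rewrite -det_map_mx -horner_evalE -det_map_mx.
have -> : map_mx (horner_eval 'i%C) (map_mx (map_poly (real_complex R)) q) =
    - cplane_conj Y.
  rewrite cplane_conjE; apply/matrixP => i j; rewrite !mxE /= horner_evalE.
  rewrite rmorphB /= rmorphM /= map_polyX !map_polyC /= !hornerE /=.
  by rewrite opprB mulrC.
by rewrite -scaleN1r detZ => /eqP; rewrite mulf_eq0 signr_eq0.
Qed.

Lemma poly_pos_nonroot (R : realFieldType) (p : {poly R}) :
  p != 0 -> exists2 T, 0 < T & p.[T] != 0.
Proof.
(* The points 1, ..., [size p] are too many to be all roots of [p]. *)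
move=> p0; have us : uniq [seq (i.+1%:R : R) | i <- iota 0 (size p)].
  rewrite map_inj_uniq ?iota_uniq // => i j /eqP.
  by rewrite eqr_nat eqSS => /eqP.
have := contraNN (fun x => max_poly_roots p0 x us).
rewrite size_map size_iota ltnn => /(_ isT) /allPn[_ /mapP[i _ ->] pi].
by exists i.+1%:R => //; rewrite ltr0n.
Qed.

(** * Eigenvalues of the Maslov matrix *)

Lemma maslov_Gamma_vert (R : realType) n (Y : 'M[R]_(n + n, n)) :
  lagrangian_plane Y ->
  maslov_Gamma (vert R n) Y = cplane_conj Y *m invmx (cplane Y).
Proof.
move=> lagY; rewrite /maslov_Gamma.
have -> : cplane (vert R n) = 'i%C%:M.
  rewrite cplaneE /vert col_mxKu col_mxKd map_mx0 map_mx1 add0r.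
  by rewrite scalemx1.
have -> : cplane_conj (vert R n) = (- 'i%C)%:M.
  rewrite cplane_conjE /vert col_mxKu col_mxKd map_mx0 map_mx1 add0r.
  by rewrite scalemx1 raddfN.
rewrite invmx_scalar -scalar_mxM.
have -> : 'i%C * (- 'i%C)^-1 = - 1 :> R[i].
  rewrite invrN mulrN divff //.
  by rewrite eq_complex /= oner_eq0 andbF.
by rewrite mul_scalar_mx scaleN1r !mulNmx opprK.
Qed.

(** Since exp(i (pi + x)) = - exp(ix), the difference is ((X - iU) + exp(ix) (X + iU)) (X + iU)^-1;
    pulling out exp(ix/2) leaves twice a cosine and a sine of the half angle. *)
Lemma maslov_Gamma_sub (R : realType) n (Y : 'M[R]_(n + n, n)) (x : R) :
  lagrangian_plane Y ->
  maslov_Gamma (vert R n) Y - (expi (pi + x))%:M =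
  (2 * expi (x / 2)) *: (map_mx (real_complex R)
     (cos (x / 2) *: usubmx Y - sin (x / 2) *: dsubmx Y) *m invmx (cplane Y)).
Proof.
move=> lagY; have [Zu _] := cplane_unit lagY.
rewrite maslov_Gamma_vert // -[_%:M](mulmxK Zu) mul_scalar_mx -mulmxBl scalemxAl.
congr (_ *m _); apply/matrixP => i j; rewrite !mxE.
have [y ->] : exists y, x = y + y by exists (x / 2); rewrite -splitr.
have -> : (y + y) / 2 = y by field.
rewrite /expi (addrC pi) cosDpi sinDpi cosD sinD; apply/eqP; rewrite eq_complex /=.
have cs : sin y * sin y = 1 - cos y * cos y.
  by rewrite -!expr2 -(cos2Dsin2 y) addrC addKr.
by move: (cos y) (sin y) cs => c s ss; apply/andP; split; apply/eqP; ring: ss.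
Qed.

Lemma maslov_Gamma_sub_tilt (R : realType) n (Y : 'M[R]_(n + n, n)) (x : R) :
  lagrangian_plane Y -> cos (x / 2) != 0 ->
  maslov_Gamma (vert R n) Y - (expi (pi + x))%:M =
  (- (2 * expi (x / 2) * (cos (x / 2))%:C%C)) *:
    (map_mx (real_complex R) (tilt (tan (x / 2)) Y) *m invmx (cplane Y)).
Proof.
move=> lagY c0; rewrite maslov_Gamma_sub //.
have -> : cos (x / 2) *: usubmx Y - sin (x / 2) *: dsubmx Y =
    - cos (x / 2) *: tilt (tan (x / 2)) Y.
  by apply/matrixP => i j; rewrite !mxE /tan; field.
rewrite map_mxZ -scalemxAl scalerA; congr (_ *: _).
by rewrite rmorphN /= mulrN.
Qed.

Lemma gamma_factor_neq0 (R : realType) (x : R) : cos (x / 2) != 0 ->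
  - (2 * expi (x / 2) * (cos (x / 2))%:C%C) != 0 :> R[i].
Proof.
move=> c0; rewrite oppr_eq0 !mulf_eq0 !negb_or pnatr_eq0 /=; apply/andP; split.
  by rewrite eq_complex /= negb_and c0.
by rewrite eq_complex /= negb_and c0.
Qed.

Lemma maslov_Gamma_unit (R : realType) n (Y : 'M[R]_(n + n, n)) (x : R) :
  lagrangian_plane Y -> cos (x / 2) != 0 ->
  (maslov_Gamma (vert R n) Y - (expi (pi + x))%:M \in unitmx) =
  (tilt (tan (x / 2)) Y \in unitmx).
Proof.
move=> lagY c0; have [Zu _] := cplane_unit lagY.
rewrite maslov_Gamma_sub_tilt // unitmxZ ?unitfE ?gamma_factor_neq0 //.
by rewrite unitmx_mul unitmx_inv Zu andbT map_unitmx.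
Qed.

Lemma rank_eigenspace_Gamma (R : realType) n (Y : 'M[R]_(n + n, n)) (x : R) :
  lagrangian_plane Y -> cos (x / 2) != 0 ->
  \rank (eigenspace (maslov_Gamma (vert R n) Y) (expi (pi + x))) =
  (n - \rank (tilt (tan (x / 2)) Y))%N.
Proof.
move=> lagY c0; have [Zu _] := cplane_unit lagY.
rewrite mxrank_ker maslov_Gamma_sub_tilt // mxrank_scale_nz ?gamma_factor_neq0 //.
by rewrite mxrankMfree ?row_free_unit ?unitmx_inv // mxrank_map.
Qed.

(** With D the tilt at T and A the slope, X = A D and T U = (1 + A) D. Then t U - X is a nonzero
    multiple of (A - t / (T - t)) D. *)
Lemma rank_tilt_slope (R : realType) n (T t : R) (Y : 'M[R]_(n + n, n)) :
  T != 0 -> t != T -> tilt T Y \in unitmx ->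
  (n - \rank (tilt t Y) = \rank (eigenspace (slope T Y) (t / (T - t))))%N.
Proof.
move=> T0 tT Du; rewrite mxrank_ker; congr subn.
have Tt0 : T - t != 0 by rewrite subr_eq0 eq_sym.
have -> : tilt t Y = - ((T - t) / T) *: ((slope T Y - (t / (T - t))%:M) *m tilt T Y).
  rewrite mulmxBl slopeK // mul_scalar_mx /tilt.
  by apply/matrixP => i j; rewrite !mxE; field; rewrite Tt0.
have c0 : - ((T - t) / T) != 0 by rewrite oppr_eq0 mulf_neq0 ?invr_neq0.
by rewrite mxrank_scale_nz // mxrankMfree // row_free_unit.
Qed.

Lemma arc_count_vert (R : realType) n (Y : 'M[R]_(n + n, n)) (e : R) :
  0 < e < pi -> lagrangian_plane Y -> tilt (tan (e / 2)) Y \in unitmx ->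
  arc_count (maslov_Gamma (vert R n) Y) e =
  (n - \rank (slope (tan (e / 2)) Y) + neg_index (- slope (tan (e / 2)) Y))%N.
Proof.
move=> /andP[e_gt0 e_ltpi] lagY; set T := tan (e / 2) => Du.
have symA := slope_sym lagY.1 Du.
have half_itv x : 0 <= x < e -> x / 2 \in `](- (pi / 2)), (pi / 2)[.
  move=> /andP[x0 xe]; rewrite in_itv /=; apply/andP; split; last lra.
  by have := pi_gt0 R; lra.
have e_itv : e / 2 \in `](- (pi / 2)), (pi / 2)[.
  by rewrite in_itv /=; apply/andP; split; lra.
have cos_gt0 x : 0 <= x < e -> 0 < cos (x / 2).
  by move=> /half_itv; rewrite in_itv /=; exact: cos_gt0_pihalf.
have tan_lt x : 0 <= x < e -> tan (x / 2) < T.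
  move=> x_itv; rewrite ltNge; apply/negP => /le_atan.
  rewrite (tanK e_itv) (tanK (half_itv _ x_itv)); case/andP: x_itv => _; lra.
have tan_ge0 x : 0 <= x < e -> 0 <= tan (x / 2).
  move=> x_itv; rewrite leNgt; apply/negP => /lt_atan.
  rewrite atan0 (tanK (half_itv _ x_itv)); case/andP: x_itv; lra.
have T_gt0 : 0 < T.
  by apply: le_lt_trans (tan_ge0 0 _) (tan_lt 0 _); rewrite lexx.
have T0 : T != 0 by rewrite gt_eqF.
(* [tau] vanishes at x = 0 and tends to infinity as x approaches e, so the half-open arc corresponds
   to the closed half-line of nonnegative slope eigenvalues. *)
pose tau x := tan (x / 2) / (T - tan (x / 2)).
have tau_bij : set_bij [set x | 0 <= x < e] [set y | 0 <= y] tau.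
  split.
  - move=> x /= x_itv; apply: divr_ge0; first exact: tan_ge0.
    by rewrite subr_ge0 ltW // tan_lt.
  - move=> x y; rewrite !inE /= => x_itv y_itv tau_eq.
    have [/tan_lt xT /tan_lt yT] := (x_itv, y_itv).
    have Exy : tan (x / 2) = tan (y / 2).
      have Tx : T - tan (x / 2) != 0 by rewrite subr_eq0 gt_eqF.
      have Ty : T - tan (y / 2) != 0 by rewrite subr_eq0 gt_eqF.
      move/eqP: tau_eq; rewrite /tau eqr_div // => /eqP E.
      by apply: (mulIf T0); move: E; lra.
    have := congr1 atan Exy; rewrite !tanK ?half_itv //; lra.
  - move=> y /= y0; have y1 : 1 + y != 0 by rewrite gt_eqF // ltr_wpDr.
    have frac_lt : T * y / (1 + y) < T.
      by rewrite ltr_pdivrMr ?ltr_wpDr // ltr_pM2l // ltrDr.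
    have frac_ge0 : 0 <= T * y / (1 + y).
      by apply: divr_ge0; [apply: mulr_ge0 => //; exact: ltW|exact: addr_ge0].
    (* Solving y = u / (T - u) gives u = T y / (1 + y), where u is the tangent of the half angle. *)
    exists (atan (T * y / (1 + y)) * 2); last first.
      rewrite /tau mulfK ?pnatr_eq0 // atanK; field.
      by rewrite y1 mulrDr mulr1 addrK T0.
    have := lt_atan frac_lt; have := le_atan frac_ge0.
    by rewrite atan0 (tanK e_itv) /= => ? ?; apply/andP; split; lra.
rewrite /arc_count.
transitivity (\sum_(x \in [set x | (0 <= x < e)%R]) \rank (eigenspace (slope T Y) (tau x)))%N.
  apply: eq_fsbigr => x; rewrite inE /= => x_itv.
  rewrite rank_eigenspace_Gamma ?gt_eqF ?cos_gt0 // (rank_tilt_slope T0 _ Du) //.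
  by rewrite lt_eqF // tan_lt.
rewrite -(reindex_fsbig tau _ _ (fun y => \rank (eigenspace (slope T Y) y)) tau_bij).
have [Q [d [QQ defA]]] := symmetric_spectral symA.
have defNA : - slope T Y = Q^T *m diag_mx (- d) *m Q.
  by rewrite linearN /= mulmxN mulNmx -defA.
rewrite (sum_rank_eigenspace QQ defA) (rank_spectral QQ defA).
rewrite (neg_index_spectral QQ defNA).
rewrite -[X in (X - _)%N]card_ord -sum1_card -sumnB => [|i _]; last exact: leq_b1.
rewrite -big_split; apply: eq_bigr => i _ /=; rewrite !mxE oppr_lt0.
have -> : (d 0 i \in [set y | 0 <= y]) = (0 <= d 0 i).
  by apply/idP/idP; rewrite inE.
by case: ltgtP.
Qed.

(** * Semicontinuity of the negative index *)

Section entrywise_convergence.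
Context (R : realType) (T : Type) (F : set_system T) {FF : Filter F}.

(** Entrywise limits reduce products, determinants and inverses of matrices to scalar limits. *)
Definition mx_cvg m n (A : T -> 'M[R]_(m, n)) (A0 : 'M[R]_(m, n)) :=
  forall i j, A t i j @[t --> F] --> A0 i j.

Lemma cvg_mx_cvg m n (A : T -> 'M[R]_(m, n)) A0 :
  A t @[t --> F] --> A0 -> mx_cvg A A0.
Proof.
move=> cvgA i j.
exact: (cvg_comp A (fun M : 'M[R]_(m, n) => M i j) cvgA (@coord_continuous R m n i j A0)).
Qed.

Lemma cvg_sumr (I : finType) (P : pred I) (f : I -> T -> R) (a : I -> R) :
  (forall i, P i -> f i t @[t --> F] --> a i) ->
  \sum_(i | P i) f i t @[t --> F] --> \sum_(i | P i) a i.
Proof.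
move=> cvgf; apply: (@cvg_big R I +%R 0 P _ T F (index_enum I) f a FF cvgf).
exact: add_continuous.
Qed.

Lemma cvg_prodr (I : finType) (P : pred I) (f : I -> T -> R) (a : I -> R) :
  (forall i, P i -> f i t @[t --> F] --> a i) ->
  \prod_(i | P i) f i t @[t --> F] --> \prod_(i | P i) a i.
Proof.
move=> cvgf; apply: (@cvg_big R I *%R 1 P _ T F (index_enum I) f a FF cvgf).
exact: mul_continuous.
Qed.

Lemma mx_cvg_cst m n (A : 'M[R]_(m, n)) : mx_cvg (fun=> A) A.
Proof. by move=> i j; exact: cvg_cst. Qed.

Lemma mx_cvg_usubmx m m' n (A : T -> 'M[R]_(m + m', n)) A0 :
  mx_cvg A A0 -> mx_cvg (fun t => usubmx (A t)) (usubmx A0).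
Proof. move=> cvgA i j; rewrite mxE; under eq_cvg do rewrite mxE; exact: cvgA. Qed.

Lemma mx_cvg_dsubmx m m' n (A : T -> 'M[R]_(m + m', n)) A0 :
  mx_cvg A A0 -> mx_cvg (fun t => dsubmx (A t)) (dsubmx A0).
Proof. move=> cvgA i j; rewrite mxE; under eq_cvg do rewrite mxE; exact: cvgA. Qed.

Lemma mx_cvgB m n (A B : T -> 'M[R]_(m, n)) A0 B0 :
  mx_cvg A A0 -> mx_cvg B B0 -> mx_cvg (fun t => A t - B t) (A0 - B0).
Proof.
move=> cA cB i j; rewrite !mxE; under eq_cvg do rewrite !mxE.
by apply: cvgB; [exact: cA|exact: cB].
Qed.

Lemma mx_cvgZ m n (f : T -> R) (a : R) (A : T -> 'M[R]_(m, n)) A0 :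
  f t @[t --> F] --> a -> mx_cvg A A0 ->
  mx_cvg (fun t => f t *: A t) (a *: A0).
Proof.
move=> cvgf cvgA i j; rewrite !mxE; under eq_cvg do rewrite !mxE.
by apply: cvgM => //; exact: cvgA.
Qed.

Lemma mx_cvgM m n p (A : T -> 'M[R]_(m, n)) (B : T -> 'M[R]_(n, p)) A0 B0 :
  mx_cvg A A0 -> mx_cvg B B0 -> mx_cvg (fun t => A t *m B t) (A0 *m B0).
Proof.
move=> cA cB i j; rewrite mxE; under eq_cvg do rewrite mxE.
by apply: cvg_sumr => k _; apply: cvgM; [exact: cA|exact: cB].
Qed.

Lemma cvg_det n (A : T -> 'M[R]_n) A0 :
  mx_cvg A A0 -> \det (A t) @[t --> F] --> \det A0.
Proof.
move=> cvgA; apply: cvg_sumr => s _; apply: cvgM; first exact: cvg_cst.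
by apply: cvg_prodr => i _.
Qed.

Lemma near_unitmx n (A : T -> 'M[R]_n) A0 :
  mx_cvg A A0 -> A0 \in unitmx -> \forall t \near F, A t \in unitmx.
Proof.
move=> cvgA; rewrite unitmxE unitfE => A0u.
have detA : \forall t \near F, \det (A t) != 0 by exact: cvgr_neq0 (cvg_det cvgA) A0u.
by apply: filterS detA => t; rewrite unitmxE unitfE.
Qed.

Lemma mx_cvgV n (A : T -> 'M[R]_n) A0 :
  mx_cvg A A0 -> A0 \in unitmx -> mx_cvg (fun t => invmx (A t)) (invmx A0).
Proof.
move=> cvgA A0u i j; have detA0 : \det A0 != 0 by rewrite -unitfE -unitmxE.
have : (\det (A t))^-1 * (\adj (A t)) i j @[t --> F] --> (\det A0)^-1 * (\adj A0) i j.
  apply: cvgM; first by apply: cvgV => //; exact: cvg_det.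
  rewrite mxE; under eq_cvg do rewrite mxE.
  apply: cvgM; first exact: cvg_cst.
  by apply: cvg_det => k l; rewrite !mxE; under eq_cvg do rewrite !mxE; exact: cvgA.
have -> : invmx A0 i j = (\det A0)^-1 * \adj A0 i j.
  by rewrite /invmx A0u mxE.
(* Cramer's formula is known to give [invmx] only at invertible matrices, that is, eventually along
   the filter. *)
apply: cvg_trans; apply: near_eq_cvg.
have Au : \forall t \near F, A t \in unitmx by exact: near_unitmx.
apply: filterS Au => t Atu.
by rewrite /invmx Atu [RHS]mxE.
Qed.

End entrywise_convergence.

(** Diagonalizing the form on a maximal negative test space and dividing each direction by the root
    of minus its eigenvalue makes it exactly -1, so that a perturbation can be measured against
    1. *)
Lemma neg_index_normalized (R : realType) n (A : 'M[R]_n) : A^T = A ->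
  exists B : 'M[R]_(neg_index A, n), B *m A *m B^T = - 1%:M.
Proof.
move=> symA; have [B negB] := negdef_on_neg_index symA.
have [Q [d [QQ defG]]] := symmetric_spectral (trmx_congr B symA).
have d_lt0 i : d 0 i < 0.
  have QTQ : Q^T *m Q = 1%:M by apply: mulmx1C.
  have Qi0 : row i Q != 0.
    apply/eqP => Qi; have /matrixP/(_ 0 i)/eqP : row i (Q *m Q^T) = 0.
      by rewrite row_mul Qi mul0mx.
    by rewrite QQ !mxE eqxx oner_eq0.
  have := negB _ Qi0; rewrite defG rowE trmx_mul !mulmxA !(mulmxKtr _ QQ).
  by rewrite -!rowE row_diag_mx -scalemxAl trmx_delta mul_delta_mx !mxE !eqxx mulr1.
pose e : 'rV[R]_(neg_index A) := \row_i (Num.sqrt (- d 0 i))^-1.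
exists (diag_mx e *m Q *m B).
rewrite !trmx_mul tr_diag_mx !mulmxA -(mulmxA _ B) -(mulmxA _ (B *m A)) defG !mulmxA.
rewrite !(mulmxKtr _ QQ) !mulmx_diag -diag_const_mx -raddfN /=; congr diag_mx.
apply/rowP => i; rewrite !mxE.
have di : 0 < - d 0 i by rewrite oppr_gt0.
have s0 : Num.sqrt (- d 0 i) != 0 by rewrite sqrtr_eq0 -ltNge.
have : d 0 i = - (Num.sqrt (- d 0 i) * Num.sqrt (- d 0 i)).
  by rewrite -expr2 sqr_sqrtr ?opprK // ltW.
by move: (Num.sqrt _) s0 => s s0 ->; field.
Qed.

Lemma quad_form_bound (R : realDomainType) k (E : 'M[R]_k) (v : 'rV[R]_k) :
  (v *m E *m v^T) 0 0 <= (\sum_i \sum_j `|E i j|) * \sum_i v 0 i ^+ 2.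
Proof.
have -> : (v *m E *m v^T) 0 0 = \sum_i \sum_j v 0 i * E i j * v 0 j.
  rewrite mxE exchange_big /=; apply: eq_bigr => j _.
  by rewrite !mxE mulr_suml.
rewrite mulr_suml; apply: ler_sum => i _; rewrite mulr_suml; apply: ler_sum => j _.
apply: le_trans (ler_norm _) _; rewrite !normrM mulrAC mulrC.
apply: ler_wpM2l => //.
have vs l : `|v 0 l| ^+ 2 <= \sum_i v 0 i ^+ 2.
  rewrite real_normK ?num_real // (bigD1 l) //= lerDl.
  by apply: sumr_ge0 => m _; exact: sqr_ge0.
have := vs i; have := vs j; move: (\sum_i _) `|v 0 i| `|v 0 j| => S x y yS xS.
have : 0 <= (x - y) ^+ 2 by exact: sqr_ge0.
by nra.
Qed.

Section semicontinuity.
Context (R : realType) (T : Type) (F : set_system T) {FF : Filter F}.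

(** On a normalized test space for [A0], the form of [A t] is -1 plus an error [E t]. Once the
    entries of the error sum to less than 1 in absolute value, the form stays negative definite
    there. *)
Lemma neg_index_lower_semicontinuous n (A : T -> 'M[R]_n) (A0 : 'M[R]_n) :
  mx_cvg F A A0 -> A0^T = A0 -> (\forall t \near F, (A t)^T = A t) ->
  \forall t \near F, (neg_index A0 <= neg_index (A t))%N.
Proof.
move=> cvgA symA0 symA; have [B BAB] := neg_index_normalized symA0.
pose E t := B *m A t *m B^T + 1%:M.
have cvgE : \sum_i \sum_j `|E t i j| @[t --> F] --> (0 : R).
  have sum0 : \sum_(i < neg_index A0) \sum_(j < neg_index A0) `|(0 : R)| = 0.
    by rewrite big1 // => i _; rewrite big1 // => j _; rewrite normr0.
  rewrite -[X in _ --> X]sum0.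
  apply: cvg_sumr => i _; apply: cvg_sumr => j _; apply: cvg_norm.
  have -> : (0 : R) = (B *m A0 *m B^T + 1%:M) i j by rewrite BAB addNr mxE.
  rewrite /E mxE; under eq_cvg do rewrite mxE.
  apply: cvgD; last exact: cvg_cst.
  by apply: mx_cvgM; [apply: mx_cvgM => //; exact: mx_cvg_cst|exact: mx_cvg_cst].
have nearE : \forall t \near F, \sum_i \sum_j `|E t i j| < 1.
  by apply: cvgr_lt cvgE _ _.
apply: filterS2 symA nearE => t symAt Et.
apply: (@negdef_on_leq _ _ _ B) => // v v0.
have vv_gt0 : 0 < \sum_i v 0 i ^+ 2.
  rewrite lt_def sumr_ge0 => [|i _]; last exact: sqr_ge0.
  rewrite andbT; apply: contra_neq v0 => vv; apply: row_mul_tr_eq0.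
  by rewrite -vv mxE; apply: eq_bigr => i _; rewrite mxE expr2.
have -> : B *m A t *m B^T = E t - 1%:M by rewrite /E addrK.
have mxB (X X' : 'M[R]_1) : (X - X') 0 0 = X 0 0 - X' 0 0 by rewrite !mxE.
rewrite mulmxBr mulmxBl mulmx1 mxB.
have -> : (v *m v^T) 0 0 = \sum_i v 0 i ^+ 2.
  by rewrite mxE; apply: eq_bigr => i _; rewrite mxE expr2.
rewrite subr_lt0; apply: le_lt_trans (quad_form_bound _ _) _.
by rewrite gtr_pMl.
Qed.

(** Neither the index of A nor that of -A can drop nearby, while their sum is the rank, which stays
    constant. *)
Lemma near_neg_index_eq n (A : T -> 'M[R]_n) (A0 : 'M[R]_n) :
  mx_cvg F A A0 -> A0^T = A0 -> (\forall t \near F, (A t)^T = A t) ->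
  (\forall t \near F, \rank (A t) = \rank A0) ->
  \forall t \near F, neg_index (A t) = neg_index A0.
Proof.
move=> cvgA symA0 symA rkA.
have negA := neg_index_lower_semicontinuous cvgA symA0 symA.
have cvgNA : mx_cvg F (fun t => - A t) (- A0).
  by move=> i j; rewrite mxE; under eq_cvg do rewrite mxE; apply: cvgN.
have symNA0 : (- A0)^T = - A0 by rewrite raddfN /= symA0.
have symNA : \forall t \near F, (- A t)^T = - A t.
  by apply: filterS symA => t symAt; rewrite raddfN /= symAt.
have negNA := neg_index_lower_semicontinuous cvgNA symNA0 symNA.
apply: filterS2 (filterI symA rkA) (filterI negA negNA) => t [symAt rkAt] [le1 le2].
have := neg_index_addN symAt; rewrite rkAt -(neg_index_addN symA0).
lia.
Qed.

End semicontinuity.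

(** * Subdivisions of an interval *)

(** Continuous induction: let S be the set of x with P c x. The local hypothesis at sup S bridges
    from a point of S just below it to a point beyond it, unless [d] is reached. *)
Lemma interval_local_to_global (R : realType) (c d : R) (P : R -> R -> Prop) :
  c <= d ->
  (forall x y z, P x y -> P y z -> P x z) ->
  (forall t0, t0 \in `[c, d] -> exists Q : R -> Prop,
     (\forall t \near within [set` `[c, d]] (nbhs t0), Q t) /\
     forall x y, x <= y -> (forall t, t \in `[x, y] -> Q t) -> P x y) ->
  P c d.
Proof.
move=> cd Ptrans Ploc.
have local t0 : t0 \in `[c, d] -> exists2 r, 0 < r & forall x y,
    x <= y -> c <= x -> y <= d -> t0 - r < x -> y < t0 + r -> P x y.
  move=> /Ploc[Q [/nbhs_ballP[r /= r0 rQ] QP]]; exists r => // x y xy cx yd rx ry.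
  apply: QP => // t; rewrite in_itv /= => /andP[xt ty].
  apply: rQ; last by rewrite /= in_itv /=; apply/andP; split; lra.
  by rewrite /ball /= ltr_norml; apply/andP; split; lra.
pose S := [set x | c <= x <= d /\ P c x].
have Sc : S c.
  split; first by rewrite lexx.
  have [|r r0] := local c; first by rewrite in_itv /= lexx.
  by apply => //; lra.
have ubS : ubound S d by move=> x [/andP[_ xd] _].
have hsS : has_sup S by split; [exists c|exists d].
have s_itv : c <= sup S <= d.
  by rewrite (ub_le_sup _ Sc) ?ge_sup //; [exists c|exists d].
have [r r0 rP] : exists2 r, 0 < r & forall x y,
    x <= y -> c <= x -> y <= d -> sup S - r < x -> y < sup S + r -> P x y.
  by apply: local; rewrite in_itv.
have [x Sx sx] := sup_adherent r0 hsS.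
have xs : x <= sup S by apply: ub_le_sup => //; exists d.
have [/andP[cx xd] Pcx] := Sx; have /andP[cs sd] := s_itv.
(* The step beyond the supremum is half the local radius, capped at [d]. *)
pose y := Num.min d (sup S + r / 2).
have sy : sup S <= y by rewrite le_min sd lerDl; apply: divr_ge0; lra.
have yd : y <= d by rewrite ge_min lexx.
have yr : y < sup S + r by rewrite gt_min; apply/orP; right; lra.
have Py : P c y by apply: Ptrans Pcx (rP _ _ _ _ _ _ _) => //; lra.
have Sy : S y by split=> //; apply/andP; split=> //; lra.
have ys : y <= sup S by apply: ub_le_sup => //; exists d.
have [yd' | sr] : y = d \/ y = sup S + r / 2.
  by rewrite /y; case: leP; [left|right].
  by rewrite -yd'.
by lra.
Qed.

(** Common form of oscillation and Maslov sums: a partition read from left to right together with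
    the sum of its increments. The length index supports induction. *)
Inductive chain (R : realType) (step : R -> R -> int -> Prop) :
    nat -> R -> R -> int -> Prop :=
| chain_nil x : chain step 0 x x 0
| chain_cons k x y z v w : x < y -> step x y v -> chain step k y z w ->
    chain step k.+1 x z (v + w).

Lemma chain_le (R : realType) (step : R -> R -> int -> Prop) k x z v :
  chain step k x z v -> x <= z.
Proof. by elim=> // {}k {}x y {}z {}v w xy _ _ yz; apply: ltW (lt_le_trans xy yz). Qed.

Lemma chain_cat (R : realType) (step : R -> R -> int -> Prop) k l x y z v w :
  chain step k x y v -> chain step l y z w -> chain step (k + l) x z (v + w).
Proof.
move=> cxy cyz; elim: cxy cyz => [{}x|{}k {}x x' {}y {}v v' xx' xstep _ IH] cyz.
  by rewrite add0r.
by rewrite -addrA addSn; apply: chain_cons xx' xstep (IH cyz).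
Qed.

Lemma chain_sub (R : realType) (step step' : R -> R -> int -> Prop) k x z v :
  (forall s t u, x <= s -> s < t -> t <= z -> step s t u -> step' s t u) ->
  chain step k x z v -> chain step' k x z v.
Proof.
move=> sub cxz; elim: cxz sub => [{}x|{}k {}x y {}z {}v w xy xstep cyz IH] sub.
  exact: chain_nil.
apply: chain_cons (xy) _ _; first by apply: sub xstep => //; exact: chain_le cyz.
by apply: IH => s t u ys; apply: sub; apply: le_trans ys; exact: ltW.
Qed.

(* Two chains are compared through their common refinement. *)
Lemma chain_unique (R : realType) (step : R -> R -> int -> Prop) :
  (forall x y v v', x < y -> step x y v -> step x y v' -> v = v') ->
  (forall x y z v, x < y -> y < z -> step x z v ->
     exists v1 v2, [/\ step x y v1, step y z v2 & v = v1 + v2]) ->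
  forall k k' x z v v', chain step k x z v -> chain step k' x z v' -> v = v'.
Proof.
move=> stepU stepD k k'; have [m] := ubnP (k + k'); elim: m k k' => // m IH k k'.
rewrite ltnS => km x z v v' c1 c2.
case: c1 km c2 => {k x z v} [x|k x y z v w xy step1 c1] km c2.
  inversion c2 as [|k0 x0 y z0 v0 w xy step2 c2']; first by [].
  by have := lt_le_trans xy (chain_le c2'); rewrite ltxx.
have yz := chain_le c1.
case: c2 xy yz step1 c1 km => {k' x z v'} [x|k' x y' z v' w' xy' step2 c2] xy yz step1 c1 km.
  by move: (lt_le_trans xy yz); rewrite ltxx.
(* The longer first step is cut at the end of the shorter one. Its remainder is put back at the head
   of its own chain, and the total length still drops by one. *)
have [yy'|yy'|yy'] := ltgtP y y'.
- have [v1 [v2 [s1 s2 ->]]] := stepD _ _ _ _ xy yy' step2.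
  rewrite (stepU _ _ _ _ xy step1 s1) -addrA; congr +%R.
  apply: (IH k k'.+1) c1 (chain_cons yy' s2 c2).
  by move: km; rewrite addSn.
- have [v1 [v2 [s1 s2 ->]]] := stepD _ _ _ _ xy' yy' step1.
  rewrite (stepU _ _ _ _ xy' step2 s1) -addrA; congr +%R.
  apply: (IH k.+1 k') (chain_cons yy' s2 c1) c2.
  by move: km; rewrite addnS.
- subst y'; rewrite (stepU _ _ _ _ xy step1 step2); congr +%R.
  apply: (IH k k') c1 c2; apply: leq_trans km.
  by rewrite addSn addnS ltnS leqnSn.
Qed.

Lemma chainP (R : realType) (step : R -> R -> int -> Prop) a b N :
  (exists k, chain step k a b N) <->
  exists (s : seq R) (v : nat -> int),
    [/\ itv_partition a b s,
        forall k, (k < size s)%N -> step (part_pt a s k) (part_pt a s k.+1) (v k) &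
        N = \sum_(k < size s) v k].
Proof.
split=> [[k]|].
  elim=> {k a b N} [x|k x y z v w xy xstep _ [s [u [ys us ->]]]].
    exists [::], (fun=> 0); split=> //.
    by rewrite big_ord0.
  exists (y :: s), (fun k => if k is k'.+1 then u k' else v); split.
  - by case: ys => ? ?; split=> //=; rewrite xy.
  - move=> [_ //|l] ls; have := us _ ls; rewrite /part_pt.
    by rewrite !(set_nth_default y x) //= ltnS; exact: leqW.
  - by rewrite big_ord_recl.
case=> s [v [ps us ->]]; elim: s a v ps us => [|y s IH] a v ps us.
  exists 0%N; rewrite big_ord0 (itv_partition_nil ps); exact: chain_nil.
have ay : a < y by case: ps => /= /andP[].
have [|k ck] := IH y (fun k => v k.+1) (itv_partition_cons ps).
  move=> l ls; have := us l.+1 ls; rewrite /part_pt.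
  by rewrite !(set_nth_default y a) //= ltnS; exact: ltnW.
exists k.+1; rewrite big_ord_recl.
by apply: chain_cons ay (us 0%N _) ck.
Qed.

(** * Oscillation number and Maslov index *)

Lemma wronskian_vert (R : realType) n : wronskian (vert R n) (vert R n) = 0.
Proof. by rewrite wronskianE col_mxKu mulmx0 trmx0 mul0mx subr0. Qed.

Lemma tr_wronskian (R : realType) n (Y Yh : 'M[R]_(n + n, n)) :
  (wronskian Y Yh)^T = - wronskian Yh Y.
Proof. by rewrite !wronskianE raddfB /= !trmx_mul !trmxK opprB. Qed.

Lemma symplectic_lagrangian (R : realType) n (S : 'M[R]_(n + n)) :
  symplectic S -> lagrangian_plane (S *m vert R n).
Proof.
move=> symS; split.
  have := @wronskian_vert R n; rewrite /wronskian -{1}symS trmx_mul !mulmxA.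
  by [].
have Ju : symp_J R n \in unitmx.
  have : symp_J R n *m - symp_J R n = 1%:M.
    rewrite /symp_J opp_block_mx mulmx_block !(mulmx0, mul0mx, mulmxN, mulNmx, mulmx1).
    by rewrite !(oppr0, addr0, add0r, opprK) -scalar_mx_block.
  by case/mulmx1_unit.
have Su : S \in unitmx.
  by move: Ju; rewrite -symS unitmx_mul => /andP[].
rewrite -mxrank_tr trmx_mul mxrankMfree ?row_free_unit ?unitmx_tr // mxrank_tr.
by rewrite /vert rank_col_0mx mxrank1.
Qed.

Lemma mul_row_1_0 (R : realType) n p (L : 'M[R]_(n + n, p)) :
  row_mx 1%:M 0 *m L = usubmx L :> 'M[R]_(n, p).
Proof. by rewrite -{1}[L]vsubmxK mul_row_col mul1mx mul0mx addr0. Qed.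

Lemma rank_slope (R : realType) n (T : R) (Y : 'M[R]_(n + n, n)) :
  tilt T Y \in unitmx -> \rank (slope T Y) = \rank (usubmx Y).
Proof. by move=> Du; rewrite mxrankMfree // row_free_unit unitmx_inv. Qed.

Lemma rank_wronskian_slope (R : realType) n (T : R) (Y Yh : 'M[R]_(n + n, n)) :
  T != 0 -> wronskian Y Y = 0 -> tilt T Y \in unitmx -> tilt T Yh \in unitmx ->
  \rank (slope T Y - slope T Yh) = \rank (wronskian Y Yh).
Proof.
move=> T0 isoY Du Dhu; rewrite (wronskian_slope T0 isoY Du Dhu).
rewrite mxrank_scale_nz ?invr_eq0 // mxrankMfree ?row_free_unit //.
rewrite -[RHS]mxrank_tr trmx_mul mxrankMfree ?mxrank_tr //.
by rewrite row_free_unit trmxK.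
Qed.

Lemma mx_cvg_tilt (R : realType) n (T : R) (U : Type) (F : set_system U)
    {FF : Filter F} (Y : U -> 'M[R]_(n + n, n)) Y0 :
  mx_cvg F Y Y0 -> mx_cvg F (fun t => tilt T (Y t)) (tilt T Y0).
Proof.
move=> cvgY; apply: mx_cvgB; last exact: mx_cvg_usubmx.
by apply: mx_cvgZ; [exact: cvg_cst|exact: mx_cvg_dsubmx].
Qed.

Lemma mx_cvg_slope (R : realType) n (T : R) (U : Type) (F : set_system U)
    {FF : Filter F} (Y : U -> 'M[R]_(n + n, n)) Y0 :
  mx_cvg F Y Y0 -> tilt T Y0 \in unitmx ->
  mx_cvg F (fun t => slope T (Y t)) (slope T Y0).
Proof.
move=> cvgY Du; apply: mx_cvgM; first exact: mx_cvg_usubmx.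
by apply: mx_cvgV => //; exact: mx_cvg_tilt.
Qed.

Lemma within_cvg (R : realType) m n (c d t0 : R) (Y : R -> 'M[R]_(m, n)) :
  {within `[c, d], continuous Y} -> t0 \in `[c, d] ->
  mx_cvg (within [set` `[c, d]] (nbhs t0)) Y (Y t0).
Proof. by move=> /subspace_continuousP Yc t0cd; apply: cvg_mx_cvg; exact: Yc. Qed.

Lemma near_within (R : realType) (c d t0 : R) :
  \forall t \near within [set` `[c, d]] (nbhs t0), t \in `[c, d].
Proof. by rewrite near_withinE; apply: nearW. Qed.

(** By [comp_index_slope] both sides are sums of the indices of A - B and B. Admissibility keeps the
    ranks of these two matrices constant, so [near_neg_index_eq] applies to each. *)
Lemma near_comp_index (R : realType) n (T c d t0 : R)
    (Y : R -> 'M[R]_(n + n, n)) (S : R -> 'M[R]_(n + n)) :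
  0 < T -> t0 \in `[c, d] -> lagrangian_path c d Y -> osc_admissible c d Y S ->
  tilt T (Y t0) \in unitmx -> tilt T (S t0 *m vert R n) \in unitmx ->
  \forall t \near within [set` `[c, d]] (nbhs t0),
    (comp_index (Y t) (S t *m vert R n) + neg_index (slope T (Y t)) =
     comp_index (Y t0) (S t0 *m vert R n) + neg_index (slope T (Y t0)))%N.
Proof.
move=> T_gt0 t0cd [Yc lagY] [Sc symS rkW rkX] Du Dhu.
pose F := within [set` `[c, d]] (nbhs t0); pose L t := S t *m vert R n.
have FF : Filter F by apply: within_filter.
have T0 : T != 0 by rewrite gt_eqF.
have lagL t : t \in `[c, d] -> lagrangian_plane (L t).
  by move=> tcd; apply/symplectic_lagrangian/symS.
have cvgY : mx_cvg F Y (Y t0) by exact: within_cvg.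
have cvgL : mx_cvg F L (L t0).
  by apply: mx_cvgM; [exact: within_cvg|exact: mx_cvg_cst].
have DuF : \forall t \near F, tilt T (Y t) \in unitmx.
  by apply: near_unitmx Du; exact: mx_cvg_tilt.
have DhuF : \forall t \near F, tilt T (L t) \in unitmx.
  by apply: near_unitmx Dhu; exact: mx_cvg_tilt.
have cdF : \forall t \near F, t \in `[c, d] by exact: near_within.
have cvgA : mx_cvg F (fun t => slope T (Y t)) (slope T (Y t0)) by exact: mx_cvg_slope.
have cvgB : mx_cvg F (fun t => slope T (L t)) (slope T (L t0)) by exact: mx_cvg_slope.
have isoY t : t \in `[c, d] -> wronskian (Y t) (Y t) = 0 by move=> /lagY[].
have isoL t : t \in `[c, d] -> wronskian (L t) (L t) = 0 by move=> /lagL[].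
have symA t : t \in `[c, d] -> tilt T (Y t) \in unitmx ->
  (slope T (Y t))^T = slope T (Y t) by move=> /isoY; exact: slope_sym.
have symB t : t \in `[c, d] -> tilt T (L t) \in unitmx ->
  (slope T (L t))^T = slope T (L t) by move=> /isoL; exact: slope_sym.
have negB : \forall t \near F, neg_index (slope T (L t)) = neg_index (slope T (L t0)).
  apply: near_neg_index_eq => //; first exact: symB.
    by apply: filterS2 cdF DhuF => t; exact: symB.
  apply: filterS2 cdF DhuF => t tcd Dhut; rewrite !rank_slope //.
  by have := rkX t t0 tcd t0cd; rewrite -!mulmxA !mul_row_1_0.
have negAB : \forall t \near F, neg_index (slope T (Y t) - slope T (L t)) =
    neg_index (slope T (Y t0) - slope T (L t0)).
  apply: near_neg_index_eq; first exact: mx_cvgB.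
  - by rewrite raddfB /= symA // symB.
  - apply: filterS2 cdF (filterI DuF DhuF) => t tcd [Dut Dhut].
    by rewrite raddfB /= symA // symB.
  - apply: filterS2 cdF (filterI DuF DhuF) => t tcd [Dut Dhut].
    rewrite !rank_wronskian_slope ?isoY //.
    have := rkW t t0 tcd t0cd.
    by rewrite -(mxrank_tr (wronskian _ (Y t))) -(mxrank_tr (wronskian _ (Y t0)))
      !tr_wronskian !mxrank_opp.
apply: filterS2 (filterI cdF (filterI DuF DhuF)) (filterI negB negAB).
move=> t [tcd [Dut Dhut]] [eqB eqAB].
rewrite -[S t *m _]/(L t) -[S t0 *m _]/(L t0).
by rewrite !comp_index_slope ?isoY ?isoL // eqB eqAB.
Qed.

Lemma sub_itvcc (R : realType) (a b c d : R) :
  a <= c -> d <= b -> [set` `[c, d]] `<=` [set` `[a, b]].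
Proof.
move=> ac db t /=; rewrite !in_itv /= => /andP[ct td].
by rewrite (le_trans ac ct) (le_trans td db).
Qed.

Lemma lagrangian_pathW (R : realType) n (a b c d : R) (Y : R -> 'M[R]_(n + n, n)) :
  a <= c -> d <= b -> lagrangian_path a b Y -> lagrangian_path c d Y.
Proof.
move=> ac db [Yc lagY]; have sub := sub_itvcc ac db; split.
  exact: continuous_subspaceW sub Yc.
by move=> t /sub; exact: lagY.
Qed.

Lemma osc_admissibleW (R : realType) n (a b c d : R) (Y : R -> 'M[R]_(n + n, n))
    (S : R -> 'M[R]_(n + n)) :
  a <= c -> d <= b -> osc_admissible a b Y S -> osc_admissible c d Y S.
Proof.
move=> ac db [Sc symS rkW rkX]; have sub := sub_itvcc ac db; split.
- exact: continuous_subspaceW sub Sc.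
- by move=> t /sub; exact: symS.
- by move=> t u /sub ta /sub ua; exact: rkW.
- by move=> t u /sub ta /sub ua; exact: rkX.
Qed.

(** * Partition sums as chains of steps *)

Definition osc_step (R : realType) n (Y : R -> 'M[R]_(n + n, n)) (x y : R) (v : int) :=
  lagrangian_path x y Y /\
  exists2 S, osc_admissible x y Y S &
    v = (comp_index (Y y) (S y *m vert R n))%:Z -
        (comp_index (Y x) (S x *m vert R n))%:Z.

Definition maslov_step (R : realType) n (Y : R -> 'M[R]_(n + n, n)) (x y : R) (v : int) :=
  exists2 e, maslov_admissible x y e (fun=> vert R n) Y &
    v = (arc_count (maslov_Gamma (vert R n) (Y y)) e)%:Z -
        (arc_count (maslov_Gamma (vert R n) (Y x)) e)%:Z.

Lemma is_osc_numberP (R : realType) n a b (Y : R -> 'M[R]_(n + n, n)) N :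
  lagrangian_path a b Y ->
  is_osc_number a b Y N <-> exists k, chain (osc_step Y) k a b N.
Proof.
move=> lagY; rewrite chainP; split=> [[s [S [ps admS ->]]]|[s [v [ps us ->]]]].
  exists s, (fun k => (comp_index (Y (part_pt a s k.+1)) (S k (part_pt a s k.+1) *m vert R n))%:Z -
    (comp_index (Y (part_pt a s k)) (S k (part_pt a s k) *m vert R n))%:Z).
  split=> // k ks; split; last by exists (S k) => //; exact: admS.
  have ge_a m : (m <= size s)%N -> a <= part_pt a s m.
    move=> ms; rewrite /part_pt (set_nth_default b) //.
    exact: itv_partition_nth_ge ps.
  have le_b m : (m <= size s)%N -> part_pt a s m <= b.
    move=> ms; rewrite /part_pt (set_nth_default b) //.
    exact: itv_partition_nth_le ps.
  by apply: lagrangian_pathW lagY; [apply: ge_a; exact: ltnW|exact: le_b].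
have /choice[S HS] : forall k, exists S, (k < size s)%N ->
    osc_admissible (part_pt a s k) (part_pt a s k.+1) Y S /\
    v k = (comp_index (Y (part_pt a s k.+1)) (S (part_pt a s k.+1) *m vert R n))%:Z -
          (comp_index (Y (part_pt a s k)) (S (part_pt a s k) *m vert R n))%:Z.
  move=> k; have [ks|sk] := ltnP k (size s); last by exists (fun=> 0).
  by have [_ [S admS vk]] := us _ ks; exists S.
exists s, S; split=> // [k /HS[] //|].
by apply: eq_bigr => i _; have [_ ->] := HS i (ltn_ord i).
Qed.

Lemma is_maslov_indexP (R : realType) n a b (Y : R -> 'M[R]_(n + n, n)) N :
  is_maslov_index a b (fun=> vert R n) Y N <->
  exists k, chain (maslov_step Y) k a b N.
Proof.
rewrite chainP; split=> [[s [e [ps adme ->]]]|[s [v [ps us ->]]]].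
  exists s, (fun k => (arc_count (maslov_Gamma (vert R n) (Y (part_pt a s k.+1))) (e k))%:Z -
    (arc_count (maslov_Gamma (vert R n) (Y (part_pt a s k))) (e k))%:Z).
  split=> // k ks; by exists (e k) => //; exact: adme.
have /choice[e He] : forall k, exists e, (k < size s)%N ->
    maslov_admissible (part_pt a s k) (part_pt a s k.+1) e (fun=> vert R n) Y /\
    v k = (arc_count (maslov_Gamma (vert R n) (Y (part_pt a s k.+1))) e)%:Z -
          (arc_count (maslov_Gamma (vert R n) (Y (part_pt a s k))) e)%:Z.
  move=> k; have [ks|sk] := ltnP k (size s); last by exists 0.
  by have [e adme vk] := us _ ks; exists e.
exists s, e; split=> // [k /He[] //|].
by apply: eq_bigr => i _; have [_ ->] := He i (ltn_ord i).
Qed.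

(** Each comparative index plus the index of the slope of Y is locally constant. The slope term is
    common to both choices, so their difference [f] is locally constant, hence equal at both
    ends. *)
Lemma osc_step_unique (R : realType) n (Y : R -> 'M[R]_(n + n, n)) x y v v' :
  x < y -> osc_step Y x y v -> osc_step Y x y v' -> v = v'.
Proof.
move=> xy [lagY [S admS ->]] [_ [S' admS' ->]].
pose f t := (comp_index (Y t) (S t *m vert R n))%:Z -
  (comp_index (Y t) (S' t *m vert R n))%:Z.
suff : f x = f y by rewrite /f; lia.
apply: (@interval_local_to_global _ x y (fun s t => f s = f t)); first exact: ltW.
  by move=> r s t -> ->.
move=> t0 t0xy; have [_ symS _ _] := admS; have [_ symS' _ _] := admS'.
have [p p0 pE] := tilt_poly (lagY.2 _ t0xy).
have [q q0 qE] := tilt_poly (symplectic_lagrangian (symS _ t0xy)).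
have [q' q'0 q'E] := tilt_poly (symplectic_lagrangian (symS' _ t0xy)).
(* A nonroot of the product gives a single chart containing Y and both reference planes at [t0]. *)
have [T T_gt0] := poly_pos_nonroot (mulf_neq0 p0 (mulf_neq0 q0 q'0)).
rewrite !hornerM pE qE q'E !mulf_eq0 !negb_or -!unitfE -!unitmxE.
move=> /and3P[Du Dhu Dhu'].
have near_S := near_comp_index T_gt0 t0xy lagY admS Du Dhu.
have near_S' := near_comp_index T_gt0 t0xy lagY admS' Du Dhu'.
exists (fun t => f t = f t0); split; last first.
  move=> s t st fst; rewrite !fst // in_itv /= ?lexx ?st //.
by apply: filterS2 near_S near_S' => t; rewrite /f; lia.
Qed.

Lemma osc_step_split (R : realType) n (Y : R -> 'M[R]_(n + n, n)) x y z v :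
  x < y -> y < z -> osc_step Y x z v ->
  exists v1 v2, [/\ osc_step Y x y v1, osc_step Y y z v2 & v = v1 + v2].
Proof.
move=> /ltW xy /ltW yz [lagY [S admS ->]].
pose mu t := (comp_index (Y t) (S t *m vert R n))%:Z.
exists (mu y - mu x), (mu z - mu y); split; last by rewrite /mu; lia.
  split; first exact: lagrangian_pathW lagY.
  by exists S => //; exact: osc_admissibleW admS.
split; first exact: lagrangian_pathW lagY.
by exists S => //; exact: osc_admissibleW admS.
Qed.

(* The reference plane spanned by (sin (e/2) I, cos (e/2) I) is transversal to
   Y(t) exactly when expi (pi + e) is not an eigenvalue of Gamma(t). *)
Lemma maslov_osc_step (R : realType) n (Y : R -> 'M[R]_(n + n, n)) x y v :
  x < y -> lagrangian_path x y Y -> maslov_step Y x y v -> osc_step Y x y v.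
Proof.
move=> xy lagY [e [/andP[e_gt0 e_ltpi] adm] ->]; split=> //.
have e2 : 0 < e / 2 < pi / 2 by apply/andP; split; lra.
have s_gt0 : 0 < sin (e / 2) by apply: sin_gt0_pihalf.
have c_gt0 : 0 < cos (e / 2) by apply: cos_gt0_pihalf; apply/andP; split; lra.
(* A constant rotation by the half angle, carrying the vertical plane to the reference plane. *)
pose S : 'M[R]_(n + n) :=
  block_mx (cos (e / 2))%:M (sin (e / 2))%:M (- (sin (e / 2))%:M) (cos (e / 2))%:M.
have SE : S *m vert R n = col_mx (sin (e / 2))%:M (cos (e / 2))%:M.
  by rewrite mul_block_col !mulmx0 !mulmx1 !add0r.
have Du t : t \in `[x, y] -> tilt (tan (e / 2)) (Y t) \in unitmx.
  move=> txy; have [] := adm t txy.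
  by rewrite maslov_Gamma_unit ?gt_eqF //; exact: lagY.2.
have muE t : t \in `[x, y] ->
    arc_count (maslov_Gamma (vert R n) (Y t)) e = comp_index (Y t) (S *m vert R n).
  move=> txy; have lagt := lagY.2 _ txy.
  rewrite SE comp_index_oblique -/(tan _) ?Du //; last by case: lagt.
  by rewrite arc_count_vert ?e_gt0 ?e_ltpi ?Du.
exists (fun=> S); last by rewrite !muE // in_itv /= lexx ltW.
have symS : symplectic S.
  rewrite /symplectic /S /symp_J tr_block_mx raddfN /= !tr_scalar_mx !mulmx_block.
  rewrite !(mulmx0, mulmx1, mulmxN, mulNmx) !(add0r, addr0, opprK, oppr0).
  have ss : sin (e / 2) * sin (e / 2) = 1 - cos (e / 2) * cos (e / 2).
    by apply/eqP; rewrite eq_sym subr_eq -!expr2 addrC cos2Dsin2.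
  move: (sin _) (cos _) ss => s c ss; rewrite !mulNmx -!scalar_mxM.
  congr block_mx; apply/matrixP => i j; rewrite !mxE;
    by case: (i == j); rewrite ?mulr1n ?mulr0n; ring: ss.
split=> //.
- by apply: continuous_subspaceT => ? ; exact: cvg_cst.
- move=> t u txy uxy.
  have rkW s : s \in `[x, y] -> \rank (wronskian (S *m vert R n) (Y s)) = n.
    move=> sxy; have -> : wronskian (S *m vert R n) (Y s) =
        cos (e / 2) *: tilt (tan (e / 2)) (Y s).
      rewrite SE wronskianE col_mxKu col_mxKd !tr_scalar_mx !mul_scalar_mx.
      apply/matrixP => i j; rewrite !mxE /tan; field.
      by rewrite gt_eqF.
    by rewrite mxrank_scale_nz ?gt_eqF // mxrank_unit // Du.
  by rewrite !rkW.
Qed.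

(** If Y is transversal at [t0] to the planes with parameters T and -T, it remains so nearby, and e
    = 2 atan T is admissible there. Concatenating chains then covers [a, b]. *)
Lemma maslov_chain_exists (R : realType) n (Y : R -> 'M[R]_(n + n, n)) a b :
  a <= b -> lagrangian_path a b Y ->
  exists N k, chain (maslov_step Y) k a b N.
Proof.
move=> ab lagY.
apply: (interval_local_to_global (P := fun x y => exists N k, chain (maslov_step Y) k x y N)) => //.
  move=> x y z [v [k c1]] [w [l c2]]; exists (v + w), (k + l)%N.
  exact: chain_cat c1 c2.
move=> t0 t0ab; have lag0 := lagY.2 _ t0ab.
have [p p0 pE] := tilt_poly lag0.
(* Both T and -T must avoid the roots of [p], so the reflected polynomial joins the product. *)
have p'0 : p \Po (- 'X) != 0.
  apply: contra_neq p0 => p'0; rewrite -[p]comp_polyXr.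
  have -> : 'X = (- 'X) \Po (- 'X) :> {poly R}.
    by rewrite linearN /= comp_polyX opprK.
  by rewrite comp_polyA p'0 comp_poly0.
have [T T_gt0] := poly_pos_nonroot (mulf_neq0 p0 p'0).
rewrite hornerM horner_comp hornerN hornerX !pE mulf_eq0 negb_or -!unitfE -!unitmxE.
move=> /andP[DuP DuN].
have cvgY : mx_cvg (within [set` `[a, b]] (nbhs t0)) Y (Y t0).
  by apply: within_cvg => //; exact: lagY.1.
have nearP : \forall t \near within [set` `[a, b]] (nbhs t0), tilt T (Y t) \in unitmx.
  by apply: near_unitmx DuP; exact: mx_cvg_tilt.
have nearN : \forall t \near within [set` `[a, b]] (nbhs t0), tilt (- T) (Y t) \in unitmx.
  by apply: near_unitmx DuN; exact: mx_cvg_tilt.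
exists (fun t => [/\ t \in `[a, b], tilt T (Y t) \in unitmx &
                     tilt (- T) (Y t) \in unitmx]); split.
  apply: filterS2 (near_within a b t0) (filterI nearP nearN) => t tab [? ?].
  by split.
(* Steps have positive length, so a one-point interval takes the empty chain. *)
move=> x y; rewrite le_eqVlt => /predU1P[->|xy] Q.
  by exists 0, 0%N; exact: chain_nil.
pose e := 2 * atan T.
have e2 : e / 2 = atan T by rewrite /e; field.
have Ne2 : - e / 2 = atan (- T) by rewrite atanN -e2; field.
have [aT aN] := (atan_ltpi2 T, atan_gtNpi2 (- T)).
have a0 : 0 < atan T by rewrite -(atan0 R); exact: lt_atan.
have step : maslov_step Y x y ((arc_count (maslov_Gamma (vert R n) (Y y)) e)%:Z -
        (arc_count (maslov_Gamma (vert R n) (Y x)) e)%:Z).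
  exists e => //; split; first by apply/andP; split; rewrite /e; lra.
  move=> t /Q[tab DuPt DuNt]; have lagt := lagY.2 _ tab.
  have c_neq0 u : cos (atan u) != 0.
    by rewrite gt_eqF // cos_gt0_pihalf // atan_gtNpi2 atan_ltpi2.
  by split; rewrite maslov_Gamma_unit ?e2 ?Ne2 ?atanK // c_neq0.
by eexists; eexists; apply: chain_cons xy step (chain_nil _ _).
Qed.

Theorem corollary4p4 (R : realType) (n : nat) (a b : R) (hab : a <= b)
    (Y : R -> 'M[R]_(n + n, n)) (hY : lagrangian_path a b Y) :
  osc_number Y a b = maslov_index (fun _ : R => vert R n) Y a b.
Proof.
have maslov_osc N : is_maslov_index a b (fun=> vert R n) Y N -> is_osc_number a b Y N.
  move=> /is_maslov_indexP[k ck]; apply/is_osc_numberP => //; exists k.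
  apply: chain_sub ck => x y v ax xy yb; apply: maslov_osc_step => //.
  exact: lagrangian_pathW hY.
have osc_unique N N' : is_osc_number a b Y N -> is_osc_number a b Y N' -> N = N'.
  move=> /(is_osc_numberP _ hY)[k ck] /(is_osc_numberP _ hY)[k' ck'].
  apply: chain_unique ck ck'; first exact: osc_step_unique.
  exact: osc_step_split.
(* One Maslov sum exists, and it is also an oscillation sum; hence neither [xget] returns its
   default 0. *)
have [N] := maslov_chain_exists hab hY => /is_maslov_indexP mN.
rewrite /osc_number /maslov_index; case: xgetP => [M _ oM|no]; last first.
  by have := no N (maslov_osc _ mN).
case: xgetP => [M' _ mM'|no]; last by have := no N mN.
exact: osc_unique oM (maslov_osc _ mM').
Qed.
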